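(* Let $K$ be a field and $S=K[x_1,x_2,x_3,x_4]$ the polynomial ring in four variables over $K$. Then every monomial ideal $I\subset S$ is a Stanley ideal.
   Context: Let $S=K[x_1,\ldots,x_n]$ be a polynomial ring over a field $K$ and $I\subset S$ a monomial ideal (an ideal generated by monomials). For a monomial $u\in S$ and a subset $Z\subseteq\{x_1,\ldots,x_n\}$, $uK[Z]$ denotes the $K$-vector space spanned by the monomials $uv$ with $v$ a monomial in the variables of $Z$; it is regarded as a subspace of $S/I$ when none of these monomials lies in $I$ (so that their residue classes are linearly independent in $S/I$). A Stanley decomposition of $S/I$ is a decomposition of $S/I$ as a finite direct sum of $K$-vector spaces $$S/I=\bigoplus_{i=1}^r u_iK[Z_i],$$ where each $u_i$ is a monomial in $S$ and each $Z_i\subseteq\{x_1,\ldots,x_n\}$. The ideal $I$ is called a Stanley ideal if there exists a Stanley decomposition $S/I=\bigoplus_{i=1}^r u_iK[Z_i]$ of $S/I$ with $|Z_i|\geq \operatorname{depth}(S/I)$ for all $1\leq i\leq r$. Here $\operatorname{depth}(S/I)$ is the depth of the $S$-module $S/I$ with respect to the graded maximal ideal $(x_1,\ldots,x_n)$. *)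

(* Defs.v *)
From HB Require Import structures.
From mathcomp Require Import all_boot all_order all_algebra.
From mathcomp Require Import mpoly.
From Stdlib Require Import ClassicalEpsilon.

Set Implicit Arguments.
Unset Strict Implicit.
Unset Printing Implicit Defensive.

Import GRing.Theory.
Local Open Scope ring_scope.

(* Subsets and ideals of S are Prop-valued: MathComp's [idealr_closed] is
   restricted to boolean predicates, which would impose decidable membership. *)
Definition ideal_gen (S : comNzRingType) (G : S -> Prop) (f : S) : Prop :=
  exists s : seq (S * S),
    (forall p, p \in s -> G p.2) /\ f = \sum_(p <- s) p.1 * p.2.

Section Stanley.
Variables (n : nat) (K : fieldType).
Local Notation S := {mpoly K[n]}.

Definition monomial_ideal (I : S -> Prop) : Prop :=
  exists M : 'X_{1..n} -> Prop,
    forall f, I f <-> ideal_gen (fun g : S => exists2 m, M m & g = 'X_[m]) f.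

Definition maximal_graded_ideal : S -> Prop :=
  ideal_gen (fun g : S => exists i : 'I_n, g = 'X_i).

(* I + (s); the module (S/I)/s(S/I) is S modulo this ideal *)
Definition ideal_add_seq (I : S -> Prop) (s : seq S) : S -> Prop :=
  ideal_gen (fun g => I g \/ g \in s).

(* s is regular on M = S/I: each s_j is a nonzerodivisor on
   M/(s_0, .., s_(j-1))M, and M/sM <> 0. *)
Definition regular_sequence (I : S -> Prop) (s : seq S) : Prop :=
  (forall j, (j < size s)%N -> forall g : S,
     ideal_add_seq I (take j s) (s`_j * g) -> ideal_add_seq I (take j s) g) /\
  ~ ideal_add_seq I s 1.

Definition max_regular_length (I : S -> Prop) (d : nat) : Prop :=
  let regular_in_m s :=
    regular_sequence I s /\ (forall f, f \in s -> maximal_graded_ideal f) in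
  (exists2 s, regular_in_m s & size s = d) /\
  (forall s, regular_in_m s -> (size s <= d)%N).

(* depth (S/I) with respect to (x_1, .., x_n).  If I = S then S/I = 0 has no
   regular sequence and the value is unspecified; in that case the empty
   family is the only Stanley decomposition, so the value is never used. *)
Definition depth (I : S -> Prop) : nat :=
  epsilon (inhabits 0%N) (max_regular_length I).

(* m is one of the exponents of the monomials of uK[Z] *)
Definition stanley_monomial (u : 'X_{1..n}) (Z : {set 'I_n}) (m : 'X_{1..n}) :=
  exists2 v : 'X_{1..n}, (forall i, v i != 0%N -> i \in Z) & m = (u + v)%MM.

(* uK[Z]; as monomials form a K-basis of S, the span of a set of monomials
   consists of the polynomials supported on it *)
Definition stanley_space (u : 'X_{1..n}) (Z : {set 'I_n}) (f : S) : Prop :=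
  forall m, m \in msupp f -> stanley_monomial u Z m.

(* Each u_i K[Z_i] embeds in S/I, and every class of S/I is in a unique way a
   sum of classes of elements h_i of u_i K[Z_i]. *)
Definition stanley_decomposition (I : S -> Prop) (r : nat)
    (u : 'I_r -> 'X_{1..n}) (Z : 'I_r -> {set 'I_n}) : Prop :=
  (forall i m, stanley_monomial (u i) (Z i) m -> ~ I 'X_[m]) /\
  (forall f : S, exists! h : {ffun 'I_r -> S},
     (forall i, stanley_space (u i) (Z i) (h i)) /\ I (f - \sum_i h i)).

Definition stanley_ideal (I : S -> Prop) : Prop :=
  exists (r : nat) (u : 'I_r -> 'X_{1..n}) (Z : 'I_r -> {set 'I_n}),
    stanley_decomposition I u Z /\ forall i, (depth I <= #|Z i|)%N.

End Stanley.

(* Main.v *)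
Require Import Defs.
From mathcomp Require Import all_boot all_algebra.
From mathcomp Require Import mpoly zify ring.
From Stdlib Require Import Classical ClassicalEpsilon.

(** A Stanley decomposition of S/I is a partition of the set R of monomials
    outside I into orthants u K[Z] ([partition_stanley]). It therefore suffices
    to show that, if some regular sequence of length d on S/I lies in the graded
    maximal ideal, then d <= 4 and R is partitioned into orthants of dimension at
    least d; this is applied to a regular sequence of length depth(S/I).

    Such a regular sequence makes the Koszul cohomology of S/I vanish in all
    degrees below d ([regular_koszul_exact]). Read off at single monomials, the
    vanishing becomes combinatorics of R. For d = 0 nothing but Dickson's lemma
    is needed ([truncated_exists], [partition_truncated]).

    - Degree 0: every monomial of R has a multiple by a variable in R. Then R
      is partitioned into orthants of dimension at least 1
      ([partition_extendable]).
    - Degree 1: around each monomial m of R, the graph of the variables that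
      extend m inside R, joined when they extend it together, is connected and
      has at least two vertices ([koszul_exact1_locally_connected]).
    - Degree 2: I is zero or principal ([koszul_exact2_principal]), because two
      generators with a suitably minimal least common multiple would give a
      nontrivial class. The monomials outside a principal ideal split into
      orthants of codimension 1 ([partition_principal]).
    - Degrees 3 and 4: the quotient by a nonzero proper principal ideal has
      nontrivial cohomology in degree 3 ([koszul_exact_hypersurface]), and the
      quotient by any proper monomial ideal has some in degree 4
      ([koszul_not_exact_top]).

    The heart of the proof is d = 2 ([partition_locally_connected]). The degree 1
    condition says that through every monomial of R there is an infinite
    coordinate plane inside R, and that the graph of these planes is connected
    ([facet_exists], [facet_connected]). From this one gets a variable x_i such
    that the ideal restricted to x_i = 0 is zero or principal
    ([principal_plane_exists]): if all four restrictions failed, the least powers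
    of the variables in the saturations of I by products of two variables would
    satisfy a contradictory system of inequalities. Now S/I splits as S/(I, x_i)
    plus x_i S/(I : x_i). The first summand has the required partition, and the
    degree 1 condition passes to the second, so induction on a bound for the
    exponents of the generators finishes the proof. *)

Set Implicit Arguments.
Unset Strict Implicit.
Unset Printing Implicit Defensive.

(** * Partitions of sets of monomials into orthants *)

Section Partitions.
Variable n : nat.
Implicit Types (m u : 'X_{1..n}) (Z A : {set 'I_n}) (R : pred 'X_{1..n}).

Definition in_orthant (p : 'X_{1..n} * {set 'I_n}) m : bool :=
  [forall i, (p.1 i <= m i) && ((i \in p.2) || (m i == p.1 i))].

Lemma in_orthantP u Z m :
  reflect (stanley_monomial u Z m) (in_orthant (u, Z) m).
Proof.
apply: (iffP forallP) => [h|[v hv ->] i] /=.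
  exists (m - u)%MM.
    move=> i; rewrite mnmBE; have /andP[/= le /orP[//|/eqP ->]] := h i.
    by rewrite subnn.
  apply/mnmP => i; rewrite mnmDE mnmBE; have /andP[/= le _] := h i.
  by rewrite subnKC.
rewrite mnmDE leq_addr /=; case: (boolP (i \in Z)) => //= hi.
have vi : v i == 0%N by exact: contraNT (hv i) hi.
by rewrite (eqP vi) addn0.
Qed.

Definition orthant_partition d R :=
  exists2 l : seq ('X_{1..n} * {set 'I_n}),
    all (fun p : 'X_{1..n} * {set 'I_n} => d <= #|p.2|) l &
    forall m, count (in_orthant^~ m) l = R m.

Lemma partition_ext d R R' : R =1 R' ->
  orthant_partition d R -> orthant_partition d R'.
Proof. by move=> e [l h c]; exists l => // m; rewrite c e. Qed.

Lemma partition_le d d' R : d' <= d ->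
  orthant_partition d R -> orthant_partition d' R.
Proof.
move=> le [l h c]; exists l => //; apply: sub_all h => p /=.
exact: leq_trans.
Qed.

Lemma partition_empty d R : (forall m, ~~ R m) -> orthant_partition d R.
Proof. by move=> h; exists [::] => // m /=; rewrite (negbTE (h m)). Qed.

Lemma partition_orthant u Z : orthant_partition #|Z| (in_orthant (u, Z)).
Proof. by exists [:: (u, Z)] => /= [|m]; rewrite ?leqnn ?addn0. Qed.

Lemma partition_union d R1 R2 R :
  (forall m, R1 m + R2 m = R m)%N ->
  orthant_partition d R1 -> orthant_partition d R2 -> orthant_partition d R.
Proof.
move=> e [l1 h1 c1] [l2 h2 c2]; exists (l1 ++ l2); first by rewrite all_cat h1.
by move=> m; rewrite count_cat c1 c2 e.
Qed.

(** The form in which concrete partitions are produced: a map [f] with finitely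
    many values cuts [R] into its fibers, and each fiber is required to be the
    orthant based at the common value. *)
Lemma partition_fibers d R (s : seq 'X_{1..n}) (f : 'X_{1..n} -> 'X_{1..n})
    (Z : 'X_{1..n} -> {set 'I_n}) :
  (forall m, R m -> f m \in s) ->
  {in s, forall p, (exists2 m, R m & f m = p) -> d <= #|Z p| /\
     forall m, in_orthant (p, Z p) m = R m && (f m == p)} ->
  orthant_partition d R.
Proof.
move=> hs hZ.
pose ok p : bool := excluded_middle_informative (exists2 m, R m & f m = p).
have okP p : reflect (exists2 m, R m & f m = p) (ok p).
  by rewrite /ok; case: excluded_middle_informative => h; constructor.
pose t := [seq p <- undup s | ok p].
have tP p : p \in t = (p \in s) && ok p.
  by rewrite mem_filter mem_undup andbC.
exists [seq (p, Z p) | p <- t].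
  rewrite all_map; apply/allP => p /=; rewrite tP => /andP[ps /okP po].
  by have [] := hZ p ps po.
move=> m; rewrite count_map.
rewrite (_ : count _ _ = count (fun p => R m && (f m == p)) t); last first.
  apply: eq_in_count => p; rewrite tP => /andP[ps /okP po] /=.
  by have [_ ->] := hZ p ps po.
case Rm: (R m) => /=; last by rewrite count_pred0.
rewrite (eq_count (a2 := pred1 (f m))); last by move=> p /=; rewrite eq_sym.
rewrite count_uniq_mem ?filter_uniq ?undup_uniq // tP hs //=.
by have /okP -> : exists2 m', R m' & f m' = f m by exists m.
Qed.

(** The combinatorial side of S/I = S/(I, x_i) + x_i S/(I : x_i). *)
Lemma partition_peel d i R :
  orthant_partition d (fun m => (m i == 0) && R m) ->
  orthant_partition d (fun m => R (m + U_(i))%MM) ->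
  orthant_partition d R.
Proof.
move=> h0 [l hl cl].
have h1 : orthant_partition d (fun m => (0 < m i) && R m).
  exists [seq ((p.1 + U_(i))%MM, p.2) | p <- l]; first by rewrite all_map.
  move=> m; rewrite count_map; case: posnP => mi /=.
    rewrite (eq_count (a2 := pred0)) ?count_pred0 // => p /=.
    apply/negP => /forallP/(_ i)/andP[/=].
    by rewrite mnmDE mnm1E eqxx mi addn1.
  have em : m = ((m - U_(i)) + U_(i))%MM.
    apply/mnmP => j; rewrite mnmDE mnmBE mnm1E.
    by case: (eqVneq i j) => [<-|_] /=; lia.
  rewrite [in RHS]em -cl; apply: eq_count => p /=.
  apply: eq_forallb => j /=; rewrite mnmDE mnmBE mnm1E.
  case: (eqVneq i j) => [<-|_] /=; last by rewrite addn0 subn0.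
  by congr (_ && (_ || _)); lia.
apply: partition_union h0 h1 => m.
by case: posnP => /=; rewrite ?add0n ?addn0 //; case: (R m).
Qed.

Lemma mdeg_sub1 u i : 0 < u i -> (mdeg (u - U_(i))).+1 = mdeg u.
Proof.
move=> ui; have := mdegD (u - U_(i)) U_(i).
by rewrite submK ?lep1mP -?lt0n // mdeg1 addn1.
Qed.

(** Induction on the degree of [u]: for x_i dividing u, the hyperplane x_i = 0
    contains no multiple of u and is a single orthant of dimension |A| - 1, and
    what remains is the complement of u / x_i shifted by x_i. *)
Lemma partition_principal A u :
  orthant_partition #|A|.-1
    (fun m => in_orthant (0%MM, A) m && ~~ (u <= m)%MM).
Proof.
move: {2}(mdeg u) (erefl (mdeg u)) => k; elim: k => [|k IH] in u *.
  move=> /eqP; rewrite mdeg_eq0 => /eqP ->.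
  apply: partition_empty => m; rewrite negb_and negbK orbC.
  by rewrite (_ : (0 <= m)%MM) //; apply/mnm_lepP => j; rewrite mnm0E.
move=> du; have [i ui] : exists i, 0 < u i.
  apply/existsP; apply: contraTT isT; rewrite negb_exists => /forallP h.
  move: du; rewrite mdegE big1 // => i _.
  by have := h i; rewrite -eqn0Ngt => /eqP.
case: (boolP (i \in A)) => iA; last first.
  apply: (@partition_le #|A|); first exact: leq_pred.
  apply: partition_ext (partition_orthant 0%MM A) => m.
  case: (boolP (in_orthant _ _)) => //= /forallP/(_ i)/=.
  rewrite (negbTE iA) /= mnm0E => /eqP mi.
  by apply/esym/negP => /mnm_lepP/(_ i); rewrite mi leqNgt ui.
apply: (@partition_peel _ i).
  rewrite (_ : #|A|.-1 = #|A :\ i|); last by rewrite (cardsD1 i A) iA.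
  apply: partition_ext (partition_orthant 0%MM (A :\ i)) => m /=.
  apply/idP/idP.
    move=> /forallP h.
    have m0 : m i = 0.
      by have := h i; rewrite /= in_setD1 eqxx /= mnm0E => /eqP.
    rewrite m0 eqxx /=; apply/andP; split.
      apply/forallP => j; have := h j; rewrite /= in_setD1.
      by case: (eqVneq j i) => [->|_] //=; rewrite iA m0 mnm0E.
    by apply/negP => /mnm_lepP/(_ i); rewrite m0 leqNgt ui.
  case/and3P => /eqP m0 /forallP h _; apply/forallP => j; have := h j => /=.
  by rewrite in_setD1; case: (eqVneq j i) => [->|_] //=; rewrite m0 mnm0E.
have du' : mdeg (u - U_(i))%MM = k.
  by have := mdeg_sub1 ui; rewrite du => -[].
have [] := IH _ du'.
move=> l hl cl; exists l => // m; rewrite cl; congr (nat_of_bool (_ && ~~ _)).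
  apply: eq_forallb => j /=; rewrite !mnm0E mnmDE mnm1E.
  by case: (eqVneq i j) => [<-|_] /=; rewrite ?iA ?addn0.
apply: eq_forallb => j /=; rewrite mnmBE mnmDE mnm1E.
by rewrite leq_subLR addnC.
Qed.

End Partitions.

(** * Dickson's lemma and orthants of dimension at least one *)

(** At every stage an index at which [h] attains its minimum over the
    remaining tail is chosen. *)
Lemma nondecreasing_subsequence (h : nat -> nat) :
  exists2 s : nat -> nat, {homo s : a b / a < b} &
    {homo h \o s : a b / a <= b}.
Proof.
have pick N : exists a, N <= a /\ forall b, N <= b -> h a <= h b.
  apply: NNPP => no.
  (* Without a minimum, h would exceed every bound on the tail. *)
  have low v : forall a, N <= a -> v <= h a.
    elim: v => // v IH a Na; rewrite ltn_neqAle IH // andbT.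
    apply/eqP => e; apply: no; exists a; split=> // b Nb.
    by rewrite -e IH.
  by have := low (h N).+1 N (leqnn N); rewrite ltnn.
pose p N := proj1_sig (constructive_indefinite_description _ (pick N)).
have hp N : N <= p N /\ forall b, N <= b -> h (p N) <= h b.
  by rewrite /p; case: constructive_indefinite_description.
pose s k := iter k (fun a => p a.+1) (p 0).
have s_lt : {homo s : a b / a < b}.
  apply: homo_ltn => [b a c|a]; first exact: ltn_trans.
  by rewrite /s iterS; have [] := hp (s a).+1.
exists s => //; apply: homo_leq => [//|b a c|a] /=; first exact: leq_trans.
have le : s a <= s a.+1 by apply/ltnW/s_lt.
case: a le => [|a] le; first by have [_ ->] := hp 0.
by have [_ ->] := hp (s a).+1; rewrite // (s_lt a a.+2) // ltnW.
Qed.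

Section Truncation.
Variable n : nat.
Implicit Types (m u g : 'X_{1..n}) (B : {set 'I_n}) (R : pred 'X_{1..n}).

Lemma dickson (f : nat -> 'X_{1..n}) :
  exists2 s : nat -> nat, {homo s : a b / a < b} &
    forall a b, a <= b -> (f (s a) <= f (s b))%MM.
Proof.
suff [s s_lt hs] : exists2 s : nat -> nat, {homo s : a b / a < b} &
    forall i, i \in enum 'I_n -> {homo (fun a => f (s a) i) : a b / a <= b}.
  by exists s => // a b le; apply/mnm_lepP => i; apply: hs; rewrite ?mem_enum.
elim: (enum _) => [|i r [s s_lt hs]]; first by exists id.
have [t t_lt ht] := nondecreasing_subsequence (fun a => f (s a) i).
exists (s \o t) => [a b ab|j]; first exact/s_lt/t_lt.
rewrite inE => /orP[/eqP ->|jr] a b ab; first exact: ht.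
apply: hs => //; move: ab; rewrite leq_eqVlt => /orP[/eqP ->//|].
by move/t_lt/ltnW.
Qed.

Definition down_closed R := forall m m', (m <= m')%MM -> R m' -> R m.

(** For [R] the complement of a monomial ideal, this says that the ideal is
    generated by monomials with exponents at most [g]. *)
Definition truncated g R := forall m m',
  (forall i, minn (m i) (g i) = minn (m' i) (g i)) -> R m = R m'.

Definition trunc g m := [multinom minn (m i) (g i) | i < n].

(** Dickson's lemma. If the bound G fails at a monomial f(G) outside [R] for
    every G, then in a subsequence along which f is nondecreasing some f(G) has
    G above all the exponents of its first term; truncating f(G) at G leaves a
    multiple of that first term, so the truncation is outside [R] as well. *)
Lemma truncated_exists R : down_closed R -> exists g, truncated g R.
Proof.
move=> dR; suff [G hG] : exists G, forall m,
    R (trunc [multinom G | _ < n] m) -> R m.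
  exists [multinom G | _ < n].
  have half m m' : (forall i, minn (m i) ([multinom G | _ < n] i) =
      minn (m' i) ([multinom G | _ < n] i)) -> R m -> R m'.
    move=> e Rm; apply: hG; apply: dR Rm; apply/mnm_lepP => i.
    by rewrite mnmE -e geq_minl.
  by move=> m m' e; apply/idP/idP; apply: half.
apply: NNPP => no.
have bad G : exists m, R (trunc [multinom G | _ < n] m) && ~~ R m.
  apply: NNPP => noG; apply: no; exists G => m h; apply: NNPP => /negP nR.
  by apply: noG; exists m; rewrite h.
pose f G := proj1_sig (constructive_indefinite_description _ (bad G)).
have hf G : R (trunc [multinom G | _ < n] (f G)) && ~~ R (f G).
  by rewrite /f; case: constructive_indefinite_description.
have [s s_lt hs] := dickson f.
have s_ge a : a <= s a.
  by elim: a => // a; move/leq_ltn_trans; apply; apply: s_lt.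
have /andP[_ /negP[]] := hf (s 0).
pose b := mdeg (f (s 0)); have /andP[h _] := hf (s b).
apply: dR h; apply/mnm_lepP => i; rewrite !mnmE leq_min.
rewrite (mnm_lepP (hs 0 b _)) //= (leq_trans _ (s_ge b)) //.
by rewrite /b mdegE (bigD1 i) //= leq_addr.
Qed.

Lemma trunc_box g m : trunc g m \in
  [seq val p | p <- enum {: 'X_{1..n < (mdeg g).+1}}].
Proof.
have lt : mdeg (trunc g m) < (mdeg g).+1.
  by rewrite ltnS !mdegE leq_sum // => i _; rewrite mnmE geq_minr.
by apply/mapP; exists (BMultinom lt); rewrite ?mem_enum.
Qed.

(** The fibers of truncation at [g] are the orthants with base p <= g and
    directions the coordinates in which p meets the bound. *)
Lemma partition_truncated g R : truncated g R -> orthant_partition 0 R.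
Proof.
move=> tR; pose Z (p : 'X_{1..n}) := [set i | p i == g i].
apply: (@partition_fibers _ _ _ _ (trunc g) Z) => [m _|p _ [m Rm <-{p}]].
  exact: trunc_box.
split=> // m'.
apply/forallP/andP => [h|[Rm' /eqP <-] i]; last first.
  by rewrite /= inE !mnmE; case: (leqP (m' i) (g i)); rewrite ?eqxx ?orbT; lia.
have e i : minn (m' i) (g i) = minn (m i) (g i).
  by have := h i; rewrite /= inE mnmE; lia.
split; first by rewrite (tR m' m).
by apply/eqP/mnmP => i; rewrite !mnmE e.
Qed.

Definition set_coord m i k := [multinom if j == i then k else m j | j < n].

(** Truncate all coordinates but the i-th, and move the i-th one down to the
    first exponent at which the line in direction x_i enters [R]; all orthants
    obtained then contain the direction i. *)
Lemma partition_invariant_direction g R i : truncated g R ->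
  (forall m, R m -> R (m + U_(i))%MM) -> orthant_partition 1 R.
Proof.
move=> tR up.
have up_to m k l : k <= l -> R (set_coord m i k) -> R (set_coord m i l).
  move=> /subnKC <-; elim: (l - k) => [|t IH]; first by rewrite addn0.
  move=> /IH/up; congr R; apply/mnmP => j; rewrite !mnmE.
  by rewrite [i == j]eq_sym; case: (j == i); lia.
have self m : set_coord m i (m i) = m.
  by apply/mnmP => j; rewrite mnmE; case: eqP => [->|].
pose first m := find (fun k => R (set_coord m i k)) (iota 0 (g i).+1).
have firstP m : R m ->
    [/\ R (set_coord m i (first m)), first m <= g i &
        forall k, R (set_coord m i k) -> first m <= k].
  move=> Rm; have Rg : R (set_coord m i (g i)).
    case: (leqP (m i) (g i)) => le; first by apply: up_to le _; rewrite self.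
    rewrite -(tR m) // => j; rewrite mnmE; case: (eqVneq j i) => [->|//].
    by rewrite minnn (minn_idPr (ltnW le)).
  have hs : has (fun k => R (set_coord m i k)) (iota 0 (g i).+1).
    by apply/hasP; exists (g i) => //; rewrite mem_iota /=.
  have lt := hs; rewrite has_find size_iota in lt.
  split=> [||k Rk]; [|by []|].
    by have := nth_find 0 hs; rewrite nth_iota.
  rewrite leqNgt; apply/negP => lk; have := before_find 0 lk.
  by rewrite nth_iota ?add0n ?Rk //; apply: ltn_trans lk lt.
pose f m := set_coord (trunc g m) i (first m).
pose Z (p : 'X_{1..n}) := i |: [set j | p j == g j].
apply: (@partition_fibers _ _ _ _ f Z) => [m Rm|p _ [m Rm <-{p}]].
  have [_ le _] := firstP m Rm.
  have -> : f m = trunc g (set_coord m i (first m)).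
    by apply/mnmP => j; rewrite !mnmE; case: (eqVneq j i) => [->|//]; lia.
  exact: trunc_box.
split; first by rewrite card_gt0; apply/set0Pn; exists i; rewrite !inE eqxx.
have [Rf fg f_min] := firstP m Rm.
move=> m'; apply/forallP/andP => [h|[Rm' /eqP e] j]; last first.
  have [_ fg' _] := firstP m' Rm'.
  rewrite -/(f m) -e /= !inE !mnmE; case: eqP => [->|_] /=; last by lia.
  rewrite andbT; have [_ _] := firstP m' Rm'; apply; by rewrite self.
have e j : j != i -> minn (m' j) (g j) = minn (m j) (g j).
  by move=> ji; have := h j; rewrite /= !inE mnmE (negbTE ji) mnmE; lia.
have eR k : R (set_coord m' i k) = R (set_coord m i k).
  by apply: tR => j; rewrite !mnmE; case: (eqVneq j i) => // /e.
have Rm' : R m'.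
  rewrite -(self m'); apply: up_to (_ : first m <= m' i) _; last by rewrite eR.
  by have := h i; rewrite /= !mnmE eqxx => /andP[].
split=> //; have [Rf' fg' f_min'] := firstP m' Rm'.
apply/eqP/mnmP => j; rewrite !mnmE; case: (eqVneq j i) => [_|/e //].
by apply/eqP; rewrite eqn_leq f_min' ?f_min -?eR // eR.
Qed.

Definition saturate g B m := [multinom if i \in B then g i else m i | i < n].

Lemma truncated_saturate g R B m m' : truncated g R ->
  (forall i, i \notin B -> m i = m' i) ->
  (forall i, i \in B -> g i <= m i) -> R m -> R (saturate g B m').
Proof.
move=> tR e le; rewrite (tR m (saturate g B m')) // => i.
rewrite mnmE; case: ifP => iB; last by rewrite e ?iB.
by rewrite (minn_idPr (le i iB)) minnn.
Qed.

Lemma saturateW g R B m : down_closed R -> truncated g R ->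
  R (saturate g B m) -> R m.
Proof.
move=> dR tR Rs; rewrite (tR _ (trunc g m)).
  apply: dR Rs; apply/mnm_lepP => i; rewrite !mnmE.
  by case: ifP; rewrite ?geq_minl ?geq_minr.
by move=> i; rewrite mnmE; lia.
Qed.

(** Walking inside [R] in directions outside [B], some coordinate outside [B]
    eventually passes the bound [g], and from then on it can grow forever. So
    one-step extendability yields an infinite line. *)
Lemma escape g R B : down_closed R -> truncated g R ->
  (forall m, R m -> (forall i, i \in B -> g i <= m i) ->
     exists2 j, j \notin B & R (m + U_(j))%MM) ->
  forall m, R m -> (forall i, i \in B -> g i <= m i) ->
    exists2 j, j \notin B & R (saturate g (j |: B) m).
Proof.
move=> dR tR step m; have [k] := ubnP (mdeg (g - m)%MM).
elim: k => // k IH in m *; rewrite ltnS => le Rm mB.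
have [j jB Rj] := step m Rm mB.
have mB' i : i \in B -> g i <= (m + U_(j))%MM i.
  by move=> iB; rewrite mnmDE (leq_trans (mB i iB)) ?leq_addr.
case: (leqP (g j) (m j).+1) => gj.
  exists j => //; apply: truncated_saturate tR _ _ Rj => i.
    rewrite in_setU1 negb_or mnmDE mnm1E eq_sym => /andP[/negbTE -> _].
    by rewrite addn0.
  rewrite in_setU1 => /orP[/eqP ->|/mB' //].
  by rewrite mnmDE mnm1E eqxx addn1.
have lt : mdeg (g - (m + U_(j)))%MM < k.
  apply: leq_trans le; rewrite -submDA -(@mdeg_sub1 _ (g - m)%MM j) //.
  by rewrite mnmBE subn_gt0 ltnW.
have [j' j'B Rj'] := IH _ lt Rj mB'; exists j' => //.
apply: dR Rj'; apply/mnm_lepP => i; rewrite !mnmE.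
by case: ifP => //; rewrite leq_addr.
Qed.

(** Sort the monomials of [R] by the first variable x_i along which an infinite
    line inside [R] starts: the i-th class is closed under multiplication by
    x_i. Every monomial belongs to a class by [escape]. *)
Lemma partition_extendable R : down_closed R ->
  (forall m, R m -> exists i, R (m + U_(i))%MM) -> orthant_partition 1 R.
Proof.
move=> dR step; have [g tR] := truncated_exists dR.
pose C i m := R (saturate g [set i] m).
have dC i m m' : (m <= m')%MM -> C i m' -> C i m.
  move=> le; apply: dR; apply/mnm_lepP => j; rewrite !mnmE.
  by case: ifP => // _; apply/mnm_lepP.
suff h k : k <= n ->
    orthant_partition 1 (fun m => [exists i : 'I_n, (i < k) && C i m]).
  apply: partition_ext (h n (leqnn n)) => m.
  apply/existsP/idP => [[i /andP[_ Ci]]|Rm].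
    exact: saturateW dR tR Ci.
  have [|i|i _] := escape (B := set0) dR tR _ Rm; [|by rewrite inE|].
    by move=> m' /step[i Ri] _; exists i; rewrite ?inE.
  by rewrite setU0 => Ci; exists i; rewrite ltn_ord.
elim: k => [|k IH] kn; first by apply: partition_empty => m; apply/existsP => -[].
have [i ik] : exists i : 'I_n, i = k :> nat by exists (Ordinal kn).
pose D m := C i m && ~~ [exists j : 'I_n, (j < k) && C j m].
have tC j m m' : (forall i, minn (m i) (g i) = minn (m' i) (g i)) ->
    C j m = C j m'.
  by move=> e; apply: tR => i'; rewrite !mnmE; case: ifP.
have pD : orthant_partition 1 D.
  apply: (@partition_invariant_direction g _ i) => [m m' e|m /andP[Ci no]].
    congr (_ && ~~ _); first exact: tC.
    by apply: eq_existsb => j; rewrite (tC j m m').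
  apply/andP; split.
    apply: dR Ci; apply/mnm_lepP => j; rewrite !mnmE inE eq_sym.
    by case: eqP => //; rewrite addn0.
  apply: contra no => /existsP[j /andP[jk Cj]]; apply/existsP; exists j.
  by rewrite jk (dC _ _ _ _ Cj) // lem_addr.
apply: partition_union (IH (ltnW kn)) pD => m; rewrite /D.
have -> : [exists j : 'I_n, (j < k.+1) && C j m] =
    [exists j : 'I_n, (j < k) && C j m] || C i m.
  apply/existsP/orP => [[j /andP[]]|].
    rewrite ltnS leq_eqVlt => /orP[/eqP jk|jk] Cj; [right|left].
      by rewrite (_ : i = j) //; apply/val_inj; rewrite /= jk.
    by apply/existsP; exists j; rewrite jk.
  case=> [/existsP[j /andP[jk Cj]]|Ci]; [exists j|exists i].
    by rewrite Cj (leqW jk).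
  by rewrite Ci ik leqnn.
by case: existsP; case: (C i m).
Qed.

End Truncation.

(** * Coordinate planes inside locally connected sets *)

Section LocallyConnected.
Variable n : nat.
Implicit Types (m u g : 'X_{1..n}) (B : {set 'I_n}) (R : pred 'X_{1..n}).

(** The shape of [R] around m that the vanishing of the first Koszul cohomology
    group of S/I forces: the graph on the variables x_i with x_i m
    in [R], where i and j are adjacent when x_i x_j m is in [R], is connected
    with at least two vertices. Connectedness is stated as the absence of a cut
    [B] separating two vertices. *)
Definition locally_connected R := forall m, R m ->
  (forall i, exists2 j, j != i & R (m + U_(j))%MM) /\
  (forall B i j, i \in B -> j \notin B -> R (m + U_(i))%MM -> R (m + U_(j))%MM ->
     exists i', exists j',
       [/\ i' \in B, j' \notin B & R (m + U_(i') + U_(j'))%MM]).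

Lemma locally_connected_shift R i :
  locally_connected R -> locally_connected (fun m => R (m + U_(i))%MM).
Proof.
have e m j : (m + U_(j) + U_(i) = m + U_(i) + U_(j))%MM.
  by rewrite -!addmA [(U_(j) + _)%MM]addmC.
move=> lc m /lc[two conn]; split=> [j|B a b aB bB].
  by have [k kj] := two j; exists k; rewrite // e.
rewrite !e => /(conn B a b aB bB) h /h[a' [b' [a'B b'B]]].
by exists a', b'; split=> //; rewrite !e.
Qed.

Lemma down_closed_shift R i :
  down_closed R -> down_closed (fun m => R (m + U_(i))%MM).
Proof.
move=> dR m m' /mnm_lepP le; apply: dR; apply/mnm_lepP => j.
by rewrite !mnmDE leq_add2r.
Qed.

Lemma truncated_shift g R i :
  truncated g R -> truncated (g - U_(i))%MM (fun m => R (m + U_(i))%MM).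
Proof.
move=> tR m m' e; apply: tR => j; have := e j; rewrite !mnmE; lia.
Qed.

Lemma mnm_shift_neq m k t : k != t -> (m + U_(k))%MM t = m t.
Proof. by move=> kt; rewrite mnmDE mnm1E (negbTE kt) addn0. Qed.

Lemma trunc_le g R m m' : down_closed R -> truncated g R ->
  (forall i, minn (m i) (g i) <= m' i) -> R m' -> R m.
Proof.
move=> dR tR le Rm'; rewrite (tR _ (trunc g m)).
  by apply: dR Rm'; apply/mnm_lepP => i; rewrite mnmE.
by move=> i; rewrite mnmE; lia.
Qed.

(** In four variables, with k and l the other two indices: the coordinate plane
    in directions k and l over the point with coordinates a, b at i, j lies in
    [R], which is expressed by putting x_k and x_l at the truncation bound.
    Equivalently, x_i^a x_j^b is not in the saturation of I by x_k x_l. *)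
Definition facet_at g R i j a b : bool :=
  R [multinom if k == i then a else if k == j then b else g k | k < n].

Section Facets.
Variables (g : 'X_{1..n}) (R : pred 'X_{1..n}).
Hypotheses (dR : down_closed R) (tR : truncated g R).
Local Notation A := (facet_at g R).

Lemma facet_le i j a b a' b' : a' <= a -> b' <= b -> A i j a b -> A i j a' b'.
Proof.
move=> la lb; apply: dR; apply/mnm_lepP => k; rewrite !mnmE.
by case: eqP => //; case: eqP.
Qed.

Lemma facet_sym i j a b : i != j -> A i j a b = A j i b a.
Proof.
move=> ij; congr R; apply/mnmP => k; rewrite !mnmE.
by case: (eqVneq k i) => [->|//]; rewrite (negbTE ij).
Qed.

Lemma facet_mem i j m : A i j (m i) (m j) -> R m.
Proof.
apply: trunc_le dR tR _ => k; rewrite mnmE.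
case: eqP => [->|_]; first exact: geq_minl.
by case: eqP => [->|_]; rewrite ?geq_minl ?geq_minr.
Qed.

Lemma facet_step i j k m : k != i -> k != j ->
  A i j (m i) (m j) -> R (m + U_(k))%MM.
Proof.
move=> ki kj h; apply: (@facet_mem i j); move: h.
by rewrite !mnmE (negbTE ki) (negbTE kj) !addn0.
Qed.

(** If the plane at (a, b) survives with the i-th coordinate at the bound, then
    the direction i is unbounded too and can replace the direction k. *)
Lemma facet_exchange i j k a b c : g i <= a -> A i j a b -> A j k b c.
Proof.
move=> ga; apply: trunc_le dR tR _ => t; rewrite !mnmE.
case: (eqVneq t j) => [->|tj].
  case: (eqVneq j i) => [ji|_]; last exact: geq_minl.
  by rewrite ji (leq_trans (geq_minr _ _)).
case: (eqVneq t i) => [->|_]; first exact: leq_trans (geq_minr _ _) ga.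
exact: geq_minr.
Qed.
End Facets.

End LocallyConnected.

Section FacetsInFourVariables.
Variables (g : 'X_{1..4}) (R : pred 'X_{1..4}).
Hypotheses (dR : down_closed R) (tR : truncated g R) (lcR : locally_connected R).
Local Notation A := (facet_at g R).

(** Every monomial of [R] is the base of an infinite plane inside [R]: there
    are two variables to move along at every point, hence [escape] applies once
    to get a line and once more, off that line, to get a plane. *)
Lemma facet_exists m : R m -> exists i j, i != j /\ A i j (m i) (m j).
Proof.
move=> Rm; have [|i|k _] := escape (B := set0) dR tR _ Rm; [|by rewrite inE|].
  move=> m' /lcR[two _] _; have [k _ Rk] := two ord0.
  by exists k; rewrite ?inE.
rewrite setU0 => Rk; have [|i|l lk] := escape (B := [set k]) dR tR _ Rk.
- move=> m' /lcR[two _] _; have [l lk Rl] := two k.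
  by exists l; rewrite ?inE.
- by rewrite inE => /eqP ->; rewrite mnmE inE eqxx.
rewrite inE in lk; move=> Rkl.
have /cards2P[i [j [ij eij]]] : #|~: [set l; k]| == 2.
  by rewrite cardsCs setCK cards2 lk card_ord.
exists i, j; split=> //; move: Rkl; congr R; apply/mnmP => t.
have := congr1 (fun B : {set 'I_4} => t \in B) eij.
rewrite !mnmE !inE; case: (eqVneq t i) => [->|_]; first by do 2!case: eqP.
case: (eqVneq t j) => [->|_]; first by do 2!case: eqP.
by do 2!case: eqP.
Qed.

Definition facet_within (B : {set 'I_4}) (m : 'X_{1..4}) :=
  exists i j, [/\ i != j, i \in B, j \in B & A i j (m i) (m j)].

Definition facet_across (B : {set 'I_4}) (m : 'X_{1..4}) :=
  exists i j, [/\ i \in B, j \notin B & A i j (m i) (m j)].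

Lemma facet_across_le (B : {set 'I_4}) (m m' : 'X_{1..4}) : (m <= m')%MM ->
  facet_across B m' -> facet_across B m.
Proof.
move=> /mnm_lepP le [i [j [iB jB h]]]; exists i, j; split=> //.
exact: facet_le h.
Qed.

Lemma facet_acrossC (B : {set 'I_4}) (m : 'X_{1..4}) :
  facet_across (~: B) m -> facet_across B m.
Proof.
move=> [i [j []]]; rewrite !inE negbK => iB jB h; exists j, i; split=> //.
by rewrite facet_sym //; apply: contraNneq iB => <-.
Qed.

(** A coordinate beyond the bound is a free direction, so [facet_exchange] moves
    one of the given planes across the cut. *)
Lemma facet_across_full (B : {set 'I_4}) (m : 'X_{1..4}) i :
  #|B| = 2 -> i \in B -> g i <= m i ->
  facet_within B m -> facet_within (~: B) m -> facet_across B m.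
Proof.
move=> /eqP/cards2P[a [b [ab ->{B}]]] iB gi [x [y [xy xB yB h]]] [z [_ [_ zB _ _]]].
rewrite in_setC in zB.
suff [j [jB hij]] : exists j, j \in [set a; b] /\ A i j (m i) (m j).
  by exists j, z; split=> //; exact: (facet_exchange dR tR _ _ gi hij).
have [ix|iy] : i = x \/ i = y.
- move: iB xB yB xy; rewrite !in_set2.
  by do 3!case/orP => /eqP ->; rewrite ?eqxx; auto.
- by exists y; rewrite ix.
- by exists x; rewrite iy facet_sym // eq_sym.
Qed.

(** The graph of the planes through m is connected. Were it a disjoint pair of
    edges, one could enlarge m while keeping both; at a largest such m all four
    variables extend m, so local connectedness supplies an extension by one
    variable from each edge, and a plane through this extension contradicts
    maximality unless it crosses from one edge to the other. *)
Lemma facet_connected (B : {set 'I_4}) (m : 'X_{1..4}) : #|B| = 2 ->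
  facet_within B m -> facet_within (~: B) m -> facet_across B m.
Proof.
move=> cB; have cB' : #|~: B| = 2 by rewrite cardsCs setCK card_ord cB.
have [k] := ubnP (mdeg (g - m)%MM); elim: k => // k IH in m *.
rewrite ltnS => le hB hB'.
case: (altP (@existsP _ (fun t => g t <= m t))) => [[t gt]|].
  case: (boolP (t \in B)) => tB; first exact: facet_across_full gt hB hB'.
  apply/facet_acrossC/(@facet_across_full _ _ t); rewrite ?setCK ?inE //.
rewrite negb_exists => /forallP small.
have lt t : mdeg (g - (m + U_(t)))%MM < k.
  apply: leq_trans le; rewrite -submDA -(@mdeg_sub1 _ (g - m)%MM t) //.
  by have := small t; rewrite mnmBE subn_gt0 -ltnNge.
have [i [j [ij iB jB hij]]] := hB; have [a [b [ab aB bB hab]]] := hB'.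
rewrite !in_setC in aB bB.
have dis x y : x \in B -> y \notin B -> x != y.
  by move=> xB; apply: contraNneq => <-.
have Ri : R (m + U_(i))%MM by apply: (facet_step dR tR _ _ hab); apply: dis.
have Ra : R (m + U_(a))%MM.
  by apply: (facet_step dR tR _ _ hij); rewrite eq_sym dis.
have Rm : R m by apply: dR Ri; apply: lem_addr.
have [_ /(_ B i a iB aB Ri Ra)[x [y [xB yB Rxy]]]] := lcR Rm.
have [u [v [uv huv]]] := facet_exists Rxy.
have le_x : (m <= m + U_(x))%MM by apply: lem_addr.
have le_y : (m <= m + U_(y))%MM by apply: lem_addr.
have le_xy : (m <= m + U_(x) + U_(y))%MM by rewrite -addmA lem_addr.
case: (boolP (u \in B)) (boolP (v \in B)) => uB [] vB.
- apply: facet_across_le le_x _; apply: IH => //.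
    exists u, v; split=> //; move: huv.
    by rewrite !(@mnm_shift_neq _ (m + U_(x)) y) // eq_sym dis.
  exists a, b; rewrite !in_setC; split=> //.
  by rewrite !mnm_shift_neq // dis.
- by apply: facet_across_le le_xy _; exists u, v.
- by apply: facet_across_le le_xy _; exists v, u; rewrite facet_sym // eq_sym.
- apply: facet_across_le le_y _; apply: IH => //.
    exists i, j; split=> //.
    by rewrite !mnm_shift_neq // eq_sym dis.
  exists u, v; rewrite !in_setC; split=> //; move: huv.
  rewrite (_ : m + U_(x) + U_(y) = m + U_(y) + U_(x))%MM; last first.
    by rewrite -!addmA [(U_(x) + _)%MM]addmC.
  by rewrite !(@mnm_shift_neq _ (m + U_(y)) x) // dis.
Qed.

End FacetsInFourVariables.

(** * Orthants of dimension at least two in four variables *)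

Lemma mem_uniq4 (a b c d : 'I_4) : uniq [:: a; b; c; d] ->
  forall t, t \in [:: a; b; c; d].
Proof.
move=> un t; have sub : {subset [:: a; b; c; d] <= enum 'I_4}.
  by move=> x _; rewrite mem_enum.
have sz : size (enum 'I_4) <= size [:: a; b; c; d] by rewrite size_enum_ord.
by have [_ ->] := uniq_min_size un sub sz; rewrite mem_enum.
Qed.

Section Widths.
Variables (g : 'X_{1..4}) (R : pred 'X_{1..4}).
Hypotheses (dR : down_closed R) (tR : truncated g R) (lcR : locally_connected R).
Local Notation A := (facet_at g R).

(** [B i j] is the exponent of the least power of x_j in the saturation of I by
    the product of the two variables other than x_i and x_j. *)
Definition is_width (B : 'I_4 -> 'I_4 -> nat) :=
  forall i j b, (b < B i j) = A i j 0 b.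

Lemma is_width_exists :
  (forall i, exists2 m : 'X_{1..4}, m i = 0 & ~~ R m) -> exists B, is_width B.
Proof.
move=> no; have ex i j : exists b, ~~ A i j 0 b.
  have [m mi nR] := no i; exists (m j); apply: contra nR => h.
  by apply: (facet_mem dR tR (i := i) (j := j)); rewrite mi.
exists (fun i j => ex_minn (ex i j)) => i j b.
case: ex_minnP => B nB minB; apply/idP/idP.
  by apply: contraTT => /minB; rewrite leqNgt.
by apply: contraTT; rewrite -leqNgt => le; apply: contra nB; apply: facet_le.
Qed.

(** Restricted to the hyperplane x_i = 0, the ideal has greatest common divisor
    p_i, the product of the x_t ^ (B i t) over t different from i. If p_i is in I
    the restriction is principal. If not, a plane through p_i exhibits indices
    a, b with B i a < B b a and B i b < B a b. All four p_i outside I would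
    yield such inequalities for every i; together with the one inequality that
    connectedness of the planes adds, they are contradictory. *)
Lemma principal_plane_exists B : is_width B ->
  exists i, ~~ R [multinom if t == i then 0 else B i t | t < 4].
Proof.
move=> hB; apply: NNPP => no.
pose p i := [multinom if t == i then 0 else B i t | t < 4].
have pii i : p i i = 0 by rewrite mnmE eqxx.
have pij i j : j != i -> p i j = B i j by move=> ji; rewrite mnmE (negbTE ji).
have hA i j b : A i j 0 b -> b < B i j by rewrite hB.
have nA i j : A i j 0 (B i j) = false by rewrite -hB ltnn.
have bad i : exists a b, [/\ a != b, a != i, b != i & A a b (B i a) (B i b)].
  have Rp : R (p i) by apply: NNPP => nR; apply: no; exists i; apply/negP.
  have [a [b [ab h]]] := facet_exists dR tR lcR Rp; exists a, b.
  have ai : a != i.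
    apply: contraTneq h => ai; rewrite ai pii pij ?nA //.
    by rewrite -ai eq_sym.
  have bi : b != i.
    by apply: contraTneq h => ->; rewrite facet_sym // pii pij // nA.
  by rewrite -!pij.
have lt a b x y : a != b -> A a b x y -> y < B a b /\ x < B b a.
  move=> ab h; split; apply: hA; first exact: facet_le h.
  by rewrite facet_sym 1?eq_sym //; apply: facet_le h.
(* The indices i, a and b cannot all be bad once B i c <= B a c. *)
have core i a b c : uniq [:: i; a; b; c] -> A a b (B i a) (B i b) ->
    B i c <= B a c -> False.
  move=> un h le; have mem := mem_uniq4 un.
  have /and4P[] := un; rewrite !inE !negb_or.
  case/and3P => ia ib ic /andP[ab ac] bc _.
  have [iab iba] := lt _ _ _ _ ab h.
  have [u [v [uv ua va huv]]] := bad a.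
  have [avu auv] := lt _ _ _ _ uv huv.
  have [x [y [xy xb yb hxy]]] := bad b.
  have [bxy byx] := lt _ _ _ _ xy hxy.
  have ltac : B a c < B b c.
    move: (mem u) (mem v); rewrite !inE (negbTE ua) (negbTE va) /=.
    clear - iab iba le uv avu auv.
    case/or3P => /eqP eu; case/or3P => /eqP ev; subst u v;
      by [rewrite eqxx in uv | lia].
  move: (mem x) (mem y); rewrite !inE (negbTE xb) (negbTE yb) /=.
  clear - iab iba le ltac xy bxy byx.
  case/or3P => /eqP eu; case/or3P => /eqP ev; subst x y;
    by [rewrite eqxx in xy | lia].
have [a [b [ab a0 b0 hab]]] := bad ord0; set i := ord0 in a0 b0 hab.
have [c] : exists c, c \in ~: [set i; a; b].
  apply/set0Pn; rewrite -card_gt0 cardsCs setCK card_ord subn_gt0.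
  apply: leq_ltn_trans (leq_card_setU _ _) _.
  by rewrite cards2 cards1; case: (i != a).
rewrite !inE !negb_or => /andP[/andP[ci ca] cb].
have [[ia ib ic] [ac bc ba]] :
    [/\ i != a, i != b & i != c] /\ [/\ a != c, b != c & b != a].
  by rewrite ![_ == c]eq_sym ![i == _]eq_sym [b == a]eq_sym.
have un : uniq [:: i; a; b; c] by rewrite /= !inE !negb_or ab ia ib ic ac bc.
have un' : uniq [:: i; b; a; c] by rewrite /= !inE !negb_or ba ia ib ic ac bc.
have hba : A b a (B i b) (B i a) by rewrite facet_sym.
case Bc: (B i c) => [|k]; first by apply: (core _ _ _ _ un hab); rewrite Bc.
(* Dividing p_i by x_c makes the plane over the coordinates i and c appear,
   which connectedness then links to the plane over a and b. *)
pose m : 'X_{1..4} := [multinom if t == c then k else p i t | t < 4].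
have mi : m i = 0 by rewrite mnmE (negbTE ic) pii.
have mc : m c = k by rewrite mnmE eqxx.
have ma : m a = B i a by rewrite mnmE (negbTE ac) pij.
have mb : m b = B i b by rewrite mnmE (negbTE bc) pij.
have [|||x [y [xab yic hxy]]] :=
    @facet_connected g R dR tR lcR [set a; b] m.
- by rewrite cards2 ab.
- by exists a, b; rewrite !inE !eqxx orbT ma mb; split.
- exists i, c; rewrite !inE !negb_or ca cb ia ib mi mc; split=> //.
  by rewrite -hB Bc.
have xi : x != i by apply: contraTneq xab => ->; rewrite !inE negb_or ia ib.
have xc : x != c by apply: contraTneq xab => ->; rewrite !inE negb_or ca cb.
have mx : m x = B i x by rewrite mnmE (negbTE xc) pij.
have := mem_uniq4 un y; move: yic; rewrite !inE negb_or.
case/andP => /negbTE -> /negbTE -> /= /orP[]/eqP ey; subst y.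
  by move: hxy; rewrite mi mx facet_sym // nA.
have [le _] := lt _ _ _ _ xc hxy; rewrite mc -Bc in le.
move: xab le; rewrite !inE => /orP[]/eqP -> le.
  by apply: (core _ _ _ _ un hab).
by apply: (core _ _ _ _ un' hba).
Qed.

End Widths.

(** Peel off a hyperplane x_i = 0 on which the ideal is zero or principal, so
    that its standard monomials split into orthants of dimension at least 2.
    The colon ideal (I : x_i) inherits all hypotheses, and its truncation bound
    is smaller. If the bound in direction i is already 0, the ideal does not
    involve x_i, and the description of the hyperplane describes all of [R]. *)
Lemma partition_locally_connected (R : pred 'X_{1..4}) :
  down_closed R -> locally_connected R -> orthant_partition 2 R.
Proof.
move=> dR lcR; have [g tR] := truncated_exists dR.
have [k] := ubnP (mdeg g); elim: k => // k IH in g R dR lcR tR *.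
rewrite ltnS => le.
(* P describes R on the hyperplane and does not depend on x_i. *)
have [i [P [PA Pi hP]]] : exists i : 'I_4, exists P : pred 'X_{1..4},
  [/\ forall A : {set 'I_4},
        orthant_partition #|A|.-1 (fun m => in_orthant (0%MM, A) m && P m),
      forall m m' : 'X_{1..4}, (forall j, j != i -> m j = m' j) -> P m = P m' &
      forall m : 'X_{1..4}, m i = 0 -> R m = P m].
  case: (classic (exists i, forall m : 'X_{1..4}, m i = 0 -> R m)).
    move=> [i Ri]; exists i, predT; split=> // A.
    apply: partition_le (leq_pred _) _.
    apply: partition_ext (partition_orthant 0%MM A) => m.
    by rewrite andbT.
  move=> no; have [|B hB] := @is_width_exists g R dR tR.
    move=> i; apply: NNPP => noi; apply: no; exists i => m mi.
    by apply: contraT => nR; case: noi; exists m.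
  have [i nR] := principal_plane_exists dR tR lcR hB.
  set p := [multinom _ | _ < _] in nR.
  exists i, (fun m => ~~ (p <= m)%MM); split=> [A|m m' e|m mi].
  - exact: partition_principal.
  - congr (~~ _); apply: eq_forallb => j; rewrite mnmE.
    by case: eqVneq => // /e ->.
  apply/idP/idP => [Rm|].
    by apply: contra nR => le_pm; apply: dR Rm.
  apply: contraR => nRm; apply/mnm_lepP => j; rewrite mnmE.
  case: eqP => // _; rewrite leqNgt hB; apply: contra nRm => h.
  by apply: (facet_mem dR tR (i := i) (j := j)); rewrite mi.
case: (posnP (g i)) => gi.
  apply: (@partition_le _ #|[set: 'I_4]|.-1); first by rewrite cardsT card_ord.
  apply: partition_ext (PA setT) => m; set m0 := set_coord m i 0.
  have -> : R m = R m0.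
    by apply: tR => j; rewrite mnmE; case: eqP => // ->; rewrite gi !minn0.
  rewrite hP ?mnmE ?eqxx // (Pi _ m0) => [|j ji]; last first.
    by rewrite mnmE (negbTE ji).
  rewrite (_ : in_orthant _ _) //; apply/forallP => j /=.
  by rewrite mnm0E inE.
apply: (@partition_peel _ _ i).
  apply: (@partition_le _ #|~: [set i]|.-1).
    by rewrite cardsCs setCK cards1 card_ord.
  apply: partition_ext (PA _) => m; case: (eqVneq (m i) 0) => mi /=.
    rewrite hP // (_ : in_orthant _ _) //; apply/forallP => j /=.
    by rewrite mnm0E !inE; case: eqVneq => // ->; rewrite mi.
  suff /negbTE -> : ~~ in_orthant (0%MM, ~: [set i]) m by [].
  apply: contra mi => /forallP/(_ i) /=.
  by rewrite mnm0E !inE eqxx.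
apply: (IH (g - U_(i))%MM).
- exact: down_closed_shift.
- exact: locally_connected_shift.
- exact: truncated_shift.
- by have := mdeg_sub1 gi; lia.
Qed.

(** * Ideals and Koszul cochains *)

Import GRing.Theory.
Local Open Scope ring_scope.

Definition is_ideal (S : comNzRingType) (I : S -> Prop) :=
  [/\ I 0, forall f g, I f -> I g -> I (f + g) & forall a f, I f -> I (a * f)].

Section Ideals.
Variable S : comNzRingType.
Implicit Types (I J G : S -> Prop) (f g a : S).

Lemma ideal_sub I f g : is_ideal I -> I f -> I g -> I (f - g).
Proof. by case=> _ D M If Ig; apply: D => //; rewrite -mulN1r; apply: M. Qed.

Lemma ideal_sum I (T : Type) (r : seq T) (P : pred T) (F : T -> S) :
  is_ideal I -> (forall i, P i -> I (F i)) -> I (\sum_(i <- r | P i) F i).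
Proof. by move=> [z D _] h; elim/big_ind: _. Qed.

Lemma ideal_gen_is_ideal G : is_ideal (ideal_gen G).
Proof.
split=> [|f g [s [hs ->]] [t [ht ->]]|a f [s [hs ->]]].
- by exists [::]; rewrite big_nil.
- exists (s ++ t); rewrite big_cat; split=> // p.
  by rewrite mem_cat => /orP[/hs|/ht].
- exists [seq (a * p.1, p.2) | p <- s]; split=> [p /mapP[q /hs Gq ->] //|].
  by rewrite big_map mulr_sumr; apply: eq_bigr => p _; rewrite mulrA.
Qed.

Lemma ideal_gen_mem G g : G g -> ideal_gen G g.
Proof.
move=> Gg; exists [:: (1, g)]; rewrite big_seq1 mul1r; split=> // p.
by rewrite inE => /eqP ->.
Qed.

Lemma ideal_gen_min G J : is_ideal J -> (forall g, G g -> J g) ->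
  forall f, ideal_gen G f -> J f.
Proof.
move=> hJ GJ f [s [hs ->]]; rewrite big_seq; apply: ideal_sum => // p ps.
by have [_ _ M] := hJ; apply/M/GJ/hs.
Qed.
End Ideals.

Section Koszul.
Variables (T : finType) (S : comNzRingType).
Implicit Types (x y z a : T -> S) (m v : seq T -> S) (s t : seq T).

(** The Koszul differential of a sequence [x] of ring elements, on cochains given
    by arbitrary functions on words of indices. Dropping the alternation
    condition leaves the recursion below, whose sign rule is all that the
    contraction homotopy needs. *)
Fixpoint kdiff x m s : S :=
  if s is i :: t then x i * m t - kdiff x (fun r => m (i :: r)) t else 0.

Lemma kdiff_closed (Q : S -> Prop) x m s :
  Q 0 -> (forall f g, Q f -> Q g -> Q (f - g)) ->
  (forall i t, (size t).+1 = size s -> Q (x i * m t)) -> Q (kdiff x m s).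
Proof.
move=> Q0 QB; elim: s => //= i s IH in m *; move=> h; apply: (QB); first exact: h.
by apply: IH => j t e; apply: h => /=; rewrite e.
Qed.

Lemma kdiff_ideal I x m s : is_ideal I ->
  (forall t, (size t).+1 = size s -> I (m t)) -> I (kdiff x m s).
Proof.
move=> hI h; apply: kdiff_closed => [|f g|i t /h It].
- by case: hI.
- exact: ideal_sub.
- by case: hI => _ _; apply.
Qed.

Lemma kdiff_eq0 x m s : (forall t, m t = 0) -> kdiff x m s = 0.
Proof. by elim: s m => //= i s IH m e; rewrite e IH // mulr0 subrr. Qed.

Lemma kdiffB x m v s :
  kdiff x (fun t => m t - v t) s = kdiff x m s - kdiff x v s.
Proof. by elim: s m v => [|i s IH] m v /=; rewrite ?subrr // IH; ring. Qed.

Lemma kdiffZ x c m s : kdiff x (fun t => c * m t) s = c * kdiff x m s.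
Proof. by elim: s m => [|i s IH] m /=; rewrite ?mulr0 // IH; ring. Qed.

Lemma kdiff_sum x a (F : T -> seq T -> S) s :
  kdiff x (fun t => \sum_i a i * F i t) s = \sum_i a i * kdiff x (F i) s.
Proof.
elim: s F => [|i s IH] F /=; first by rewrite big1 // => i _; rewrite mulr0.
rewrite IH mulr_sumr -sumrB; apply: eq_bigr => j _; ring.
Qed.

Definition unit_weight i : T -> S := fun j => (j == i)%:R.

Lemma kdiff_unit_weights x m s :
  kdiff x m s = \sum_i x i * kdiff (unit_weight i) m s.
Proof.
elim: s m => [|j s IH] m /=; first by rewrite big1 // => i _; rewrite mulr0.
have -> : x j * m s = \sum_i x i * (unit_weight i j * m s).
  rewrite (bigD1 j) //= /unit_weight eqxx mul1r big1 ?addr0 // => i.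
  by rewrite eq_sym => /negbTE ->; rewrite mul0r mulr0.
by rewrite IH -sumrB; apply: eq_bigr => i _; ring.
Qed.

Lemma kdiffK x m s : kdiff x (kdiff x m) s = 0.
Proof. by elim: s m => //= i s IH m; rewrite kdiffB kdiffZ IH; ring. Qed.

Lemma kdiffC x y m s : kdiff x (kdiff y m) s = - kdiff y (kdiff x m) s.
Proof.
elim: s m => [|i s IH] m /=; first by rewrite oppr0.
by rewrite !kdiffB !kdiffZ IH; ring.
Qed.

(** Multiplication by a combination of the [x i] is homotopic to zero. *)
Lemma contraction_homotopy x a m s :
  \sum_i a i * kdiff x m (i :: s) =
  (\sum_i a i * x i) * m s - kdiff x (fun t => \sum_i a i * m (i :: t)) s.
Proof.
rewrite (kdiff_sum _ _ (fun i t => m (i :: t))) mulr_suml -sumrB.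
by apply: eq_bigr => i _ /=; ring.
Qed.

(** The alternating cochain dual to the word [J], the source of explicit
    nontrivial cocycles. *)
Definition wedge (J : seq T) : seq T -> S :=
  foldr (fun i => kdiff (unit_weight i)) (fun s => (s == [::])%:R) J.

Lemma kdiff_wedge_mem i J s : i \in J -> kdiff (unit_weight i) (wedge J) s = 0.
Proof.
elim: J s => // j J IH s; rewrite inE => /= /orP[/eqP ->|iJ]; first exact: kdiffK.
by rewrite kdiffC kdiff_eq0 ?oppr0 // => t; apply: IH.
Qed.

Lemma kdiff_unit_notin i m s : i \notin s -> kdiff (unit_weight i) m s = 0.
Proof.
elim: s m => //= j s IH m; rewrite inE negb_or eq_sym => /andP[ij /IH ->].
by rewrite /unit_weight (negbTE ij) mul0r subrr.
Qed.

Lemma wedge_diag J : uniq J -> wedge J J = 1.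
Proof.
elim: J => //= i J IH /andP[iJ /IH ->].
by rewrite kdiff_unit_notin // /unit_weight eqxx mulr1 subr0.
Qed.

End Koszul.

(** * Vanishing of Koszul cohomology *)

Section Vanishing.
Variables (n : nat) (K : fieldType).
Local Notation S := {mpoly K[n]}.
Implicit Types (I J : S -> Prop) (f g : S) (fs : seq S).

Lemma ideal_add_nil I f : is_ideal I -> (ideal_add_seq I [::] f <-> I f).
Proof.
move=> hI; split=> [|If]; last by apply: ideal_gen_mem; left.
by apply: ideal_gen_min => // g [].
Qed.

Lemma ideal_add_is_ideal I fs : is_ideal (ideal_add_seq I fs).
Proof. exact: ideal_gen_is_ideal. Qed.

Lemma ideal_add_cons I f fs g : ideal_add_seq I (f :: fs) g <->
  ideal_add_seq (ideal_add_seq I [:: f]) fs g.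
Proof.
split; apply: ideal_gen_min; try exact: ideal_gen_is_ideal.
  move=> h [Ih|]; first by apply: ideal_gen_mem; left; apply: ideal_gen_mem; left.
  rewrite inE => /orP[/eqP ->|hfs]; apply: ideal_gen_mem; [left|by right].
  by apply: ideal_gen_mem; right; rewrite inE.
move=> h [|hfs]; last by apply: ideal_gen_mem; right; rewrite inE hfs orbT.
apply: ideal_gen_min; first exact: ideal_gen_is_ideal.
move=> {}h [Ih|]; first by apply: ideal_gen_mem; left.
by rewrite inE => /eqP ->; apply: ideal_gen_mem; right; rewrite inE eqxx.
Qed.

Lemma ideal_add1 I f g : is_ideal I ->
  ideal_add_seq I [:: f] g -> exists b, I (g - f * b).
Proof.
move=> hI; move: g; apply: ideal_gen_min.
  case: hI => z D M; split=> [|g h [b Ib] [c Ic]|a g [b Ib]].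
  - by exists 0; rewrite mulr0 subrr.
  - exists (b + c); rewrite (_ : _ - _ = (g - f * b) + (h - f * c)); last ring.
    exact: D.
  - exists (a * b); rewrite (_ : _ - _ = a * (g - f * b)); last ring.
    exact: M.
move=> g [Ig|]; first by exists 0; rewrite mulr0 subr0.
rewrite inE => /eqP ->; exists 1; rewrite mulr1 subrr; by case: hI.
Qed.

Lemma regular_sequence_cons I f fs : is_ideal I ->
  regular_sequence I (f :: fs) ->
  (forall g, I (f * g) -> I g) /\ regular_sequence (ideal_add_seq I [:: f]) fs.
Proof.
move=> hI [reg proper]; split.
  move=> g Ifg; apply/(ideal_add_nil g hI); apply: (reg 0%N) => //=.
  exact/(ideal_add_nil _ hI).
split=> [j js g h|h]; last by apply: proper; apply/ideal_add_cons.
by apply/ideal_add_cons; apply: (reg j.+1) => //; apply/ideal_add_cons.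
Qed.

Lemma maximal_graded_idealP f : maximal_graded_ideal f ->
  exists a : 'I_n -> S, f = \sum_i a i * 'X_i.
Proof.
move: f; apply: ideal_gen_min.
  split=> [|f g [a ->] [b ->]|c f [a ->]].
  - by exists (fun=> 0); rewrite big1 // => i _; rewrite mul0r.
  - exists (fun i => a i + b i); rewrite -big_split; apply: eq_bigr => i _ /=; ring.
  - exists (fun i => c * a i); rewrite mulr_sumr; apply: eq_bigr => i _; ring.
move=> _ [i ->]; exists (fun j => (j == i)%:R).
rewrite (bigD1 i) //= eqxx mul1r big1 ?addr0 // => j /negbTE ->.
by rewrite mul0r.
Qed.

Definition xdiff := @kdiff 'I_n S (fun i => 'X_i).

(** The k-th Koszul cohomology of S/I, computed with cochains on words,
    vanishes. *)
Definition koszul_exact I k := forall m : seq 'I_n -> S,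
  (forall s, size s = k.+1 -> I (xdiff m s)) ->
  exists v, forall s, size s = k -> I (m s - xdiff v s).

(** Let f be the first element. The contraction w of a cocycle m satisfies
    d w = f m modulo I, so w is a cocycle modulo I + (f), hence there a
    coboundary d v + f u by induction. Applying d gives f m = f (d u) modulo I,
    and f cancels. *)
Lemma regular_koszul_exact fs : forall I, is_ideal I -> regular_sequence I fs ->
  (forall f, f \in fs -> maximal_graded_ideal f) ->
  forall k, (k < size fs)%N -> koszul_exact I k.
Proof.
elim: fs => // f fs IH I hI /(regular_sequence_cons hI)[reg regs] hm k kfs m cm.
have [a fa] := maximal_graded_idealP (hm f (mem_head _ _)).
pose w t := \sum_i a i * m (i :: t).
have htp s : size s = k -> I (f * m s - xdiff w s).
  move=> es; rewrite fa -contraction_homotopy; apply: ideal_sum => // i _.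
  by case: hI => _ _ M; apply: (M); apply: (cm (i :: s)); rewrite /= es.
case: k => [|k] in kfs cm htp *.
  exists (fun=> 0) => s /size0nil ->; rewrite subr0.
  by apply: reg; have := htp [::] erefl; rewrite subr0.
have hI1 := ideal_add_is_ideal I [:: f].
have hm' h : h \in fs -> maximal_graded_ideal h.
  by move=> hfs; apply: hm; rewrite inE hfs orbT.
have cw s : size s = k.+1 -> ideal_add_seq I [:: f] (xdiff w s).
  move=> es; rewrite (_ : xdiff w s = f * m s - (f * m s - xdiff w s)); last ring.
  apply: ideal_sub => //.
    rewrite mulrC; case: hI1 => _ _; apply; apply: ideal_gen_mem; right.
    by rewrite inE.
  by apply: ideal_gen_mem; left; apply: htp.
have [v hv] := IH _ hI1 regs hm' k kfs w cw.
have ch s : exists b, size s = k -> I (w s - xdiff v s - f * b).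
  case: (eqVneq (size s) k) => [es|ne]; last by exists 0 => e; rewrite e eqxx in ne.
  by have [b Ib] := ideal_add1 hI (hv s es); exists b.
pose u s := proj1_sig (constructive_indefinite_description _ (ch s)).
have hu s : size s = k -> I (w s - xdiff v s - f * u s).
  by rewrite /u; case: constructive_indefinite_description.
exists u => s es; apply: reg.
have := @kdiff_ideal _ _ I (fun i => 'X_i) _ s hI
  (fun t (e : (size t).+1 = size s) => hu t (succn_inj (etrans e es))).
rewrite kdiffB kdiffB kdiffK subr0 kdiffZ => Iw.
rewrite (_ : _ * _ = (f * m s - xdiff w s) + (xdiff w s - f * xdiff u s)).
  by case: hI (htp s es) => _ D _ h; apply: D.
by ring.
Qed.

(** If every variable outside [J] sends x^q into I, then x^q times the cochain
    dual to [J] is a cocycle: the variables of [J] contribute zero because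
    the exterior product repeats an index. *)
Lemma wedge_cocycle I (q : 'X_{1..n}) (J : seq 'I_n) : is_ideal I ->
  (forall i, i \notin J -> I 'X_[q + U_(i)]) ->
  forall s, I (xdiff (fun t => 'X_[q] * wedge S J t) s).
Proof.
move=> hI h s; rewrite /xdiff kdiff_unit_weights; apply: ideal_sum => // i _.
rewrite kdiffZ; case: (boolP (i \in J)) => iJ.
  by rewrite kdiff_wedge_mem // !mulr0; case: hI.
rewrite mulrA -mpolyXD addmC mulrC; case: hI => _ _; apply; exact: h.
Qed.

End Vanishing.
Arguments xdiff {n K} m s /.

(** * Standard monomials of a monomial ideal *)

Section MonomialIdeals.
Variables (n : nat) (K : fieldType) (I : {mpoly K[n]} -> Prop).
Hypothesis monI : monomial_ideal I.
Local Notation S := {mpoly K[n]}.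

Lemma monomial_is_ideal : is_ideal I.
Proof.
have [M hM] := monI; have [z D P] := ideal_gen_is_ideal
  (fun g : S => exists2 m, M m & g = 'X_[m]).
split=> [|f g /hM If /hM Ig|a f /hM If]; apply/hM; [exact: z| exact: D | exact: P].
Qed.

Lemma monomial_idealP f : I f <-> (forall m, m \in msupp f -> I 'X_[m]).
Proof.
have [z D P] := monomial_is_ideal; have [M hM] := monI; split; last first.
  move=> h; rewrite [f]mpolyE big_seq; apply: ideal_sum => // m /h Im.
  by rewrite -mul_mpolyC; apply: P.
move=> /hM; move: f; apply: ideal_gen_min.
  split=> [m|f g hf hg m|a f hf m]; first by rewrite msupp0.
    by move/msuppD_le; rewrite mem_cat => /orP[/hf|/hg].
  case/msuppM_le/allpairsP => -[m1 m2] /= [_ /hf Im ->].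
  by rewrite mpolyXD; apply: P.
move=> _ [m Mm ->] m'; rewrite msuppX inE => /eqP ->.
by apply/hM; apply: ideal_gen_mem; exists m.
Qed.

Definition standard (m : 'X_{1..n}) : bool :=
  ~~ excluded_middle_informative (I 'X_[m]).

Lemma standardP m : reflect (~ I 'X_[m]) (standard m).
Proof.
by rewrite /standard; case: excluded_middle_informative => h; constructor; tauto.
Qed.

Lemma nstandard m : ~~ standard m -> I 'X_[m].
Proof. by rewrite negbK; case: excluded_middle_informative. Qed.

Lemma standard_down_closed : down_closed standard.
Proof.
move=> m m' /submK <- /standardP nI; apply/standardP => Im; apply: nI.
by rewrite mpolyXD; have [_ _] := monomial_is_ideal; apply.
Qed.

Lemma mcoeff_standard f m : I f -> standard m -> f@_m = 0.
Proof.
move=> /monomial_idealP h /standardP Rm; apply: memN_msupp_eq0.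
by apply/negP => /h.
Qed.

(** A partition of the standard monomials into orthants splits the standard
    part of a polynomial into components, one for each orthant, and comparison
    of coefficients at standard monomials shows uniqueness. *)
Lemma partition_stanley d : orthant_partition d standard ->
  exists r (u : 'I_r -> 'X_{1..n}) (Z : 'I_r -> {set 'I_n}),
    stanley_decomposition I u Z /\ forall i, (d <= #|Z i|)%N.
Proof.
move=> [l /allP hd hl]; pose x0 : 'X_{1..n} * {set 'I_n} := (0%MM, set0).
pose p (i : 'I_(size l)) := nth x0 l i.
exists (size l), (fun i => (p i).1), (fun i => (p i).2).
split; last by move=> i; apply/hd/mem_nth.
have memE i m : stanley_monomial (p i).1 (p i).2 m <-> in_orthant (p i) m.
  by case: (p i) => u Z; split=> /in_orthantP.
have cnt m : (\sum_(i < size l) in_orthant (p i) m)%N = standard m.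
  rewrite -hl -sum1_count (big_nth x0) big_mkord [RHS]big_mkcond /=.
  by apply: eq_bigr => i _; rewrite -/(p i); case: in_orthant.
have in_std i m : in_orthant (p i) m -> standard m.
  move=> im; have := cnt m; rewrite (bigD1 i) //= im.
  by case: (standard m) => //; rewrite add1n.
have disj i j m : in_orthant (p i) m -> i != j -> in_orthant (p j) m = false.
  move=> im ij; have := cnt m; rewrite (in_std i) // (bigD1 i) //= im.
  rewrite (bigD1 j) 1?eq_sym //=; by case: (in_orthant (p j) m).
split=> [i m /memE/in_std/standardP //|f].
have cover m : standard m -> exists i, in_orthant (p i) m.
  move=> sm; have := cnt m; rewrite sm => h; apply/existsP.
  apply: contraT; rewrite negb_exists => /forallP no.
  by move: h; rewrite big1 // => i _; rewrite (negbTE (no i)).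
pose h := [ffun i => \sum_(m <- msupp f | in_orthant (p i) m) f@_m *: 'X_[m]].
have hE i m : (h i)@_m = if in_orthant (p i) m then f@_m else 0.
  rewrite ffunE raddf_sum /=; under eq_bigr => k _ do rewrite mcoeffZ mcoeffX.
  case: (boolP (m \in msupp f)) => mf.
    rewrite big_mkcond (bigD1_seq m) //= ?msupp_uniq // eqxx mulr1 big1 ?addr0 //.
    by move=> k /negbTE ->; rewrite mulr0; case: ifP.
  rewrite (memN_msupp_eq0 mf) if_same big_seq_cond big1 // => k /andP[kf _].
  case: (eqVneq k m) kf => [->|_ _]; last by rewrite mulr0.
  by rewrite (negbTE mf).
have sum_orthant (h' : {ffun 'I_(size l) -> S}) i m : in_orthant (p i) m ->
    (forall j, stanley_space (p j).1 (p j).2 (h' j)) ->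
    (\sum_j h' j)@_m = (h' i)@_m.
  move=> im hh'; rewrite raddf_sum /= (bigD1 i) //= big1 ?addr0 // => j ji.
  apply: memN_msupp_eq0; apply/negP => /hh'/memE.
  by rewrite (disj i) // eq_sym.
have h_space j : stanley_space (p j).1 (p j).2 (h j).
  move=> m; rewrite mcoeff_msupp hE => hm; apply/memE.
  by move: hm; case: ifP; rewrite ?eqxx.
exists h; split=> [|h' [hh' Ih']].
  split=> //; apply/monomial_idealP => m; rewrite mcoeff_msupp => hm.
  apply: nstandard; apply: contra hm => /cover[i im].
  by rewrite mcoeffB (sum_orthant h i) // hE im subrr.
apply/ffunP => i; apply/mpolyP => m; rewrite hE; case: ifP => im.
  rewrite -(sum_orthant h' i) //; apply/eqP; rewrite -subr_eq0 -mcoeffB.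
  by rewrite (mcoeff_standard Ih') // (in_std i).
by apply/esym/memN_msupp_eq0/negP => /hh'/memE; rewrite im.
Qed.

End MonomialIdeals.

(** * Consequences of exactness in degrees zero and one *)

Lemma mcoeffXM n (K : fieldType) (u m : 'X_{1..n}) (f : {mpoly K[n]}) :
  ('X_[u] * f)@_m = if (u <= m)%MM then f@_(m - u) else 0.
Proof.
rewrite mulrC; case: ifP => [/submK em|le].
  by rewrite -[in LHS]em addmC mcoeffMX.
apply: memN_msupp_eq0; apply/negP => /msuppM_le/allpairsP[[m1 m2] /= [_]].
by rewrite msuppX inE => /eqP -> e; rewrite e lem_addl in le.
Qed.

Section LowDegrees.
Variables (n : nat) (K : fieldType) (I : {mpoly K[n]} -> Prop).
Hypothesis monI : monomial_ideal I.
Local Notation S := {mpoly K[n]}.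
Local Notation R := (standard I).

Let hI : is_ideal I := monomial_is_ideal monI.

Lemma koszul_exact0_extends m : koszul_exact I 0 -> R m ->
  exists i, R (m + U_(i))%MM.
Proof.
move=> ex Rm; apply: NNPP => no.
have cocycle s : size s = 1 -> I (xdiff (fun=> 'X_[m]) s).
  case: s => [|i [|j s]] //= _; rewrite subr0 -mpolyXD addmC; apply: nstandard.
  by apply/negP => Ri; apply: no; exists i.
have [v /(_ [::] erefl)] := ex _ cocycle.
by rewrite /= subr0; apply/standardP.
Qed.

(** For a cut [B] without crossing edges, the cochain with value x_t x^m at the
    t in [B] and 0 elsewhere is a cocycle. If it is a coboundary x_t v, the
    coefficient of x^m in v must be 1 at a vertex in [B] and 0 at one outside. *)
Lemma koszul_exact1_connected m (B : {set 'I_n}) i j : koszul_exact I 1 ->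
  i \in B -> j \notin B -> R (m + U_(i))%MM -> R (m + U_(j))%MM ->
  exists i', exists j', [/\ i' \in B, j' \notin B & R (m + U_(i') + U_(j'))%MM].
Proof.
move=> ex iB jB Ri Rj; apply: NNPP => no.
have I_cross a b : a \in B -> b \notin B -> I 'X_[(m + U_(a) + U_(b))].
  by move=> aB bB; apply: nstandard; apply/negP => Rab; apply: no; exists a, b.
pose c (s : seq 'I_n) : S :=
  if s is t :: _ then if t \in B then 'X_[(m + U_(t))] else 0 else 0.
have cE a b : 'X_a * (if b \in B then 'X_[(m + U_(b))] else 0) =
    if b \in B then 'X_[(m + U_(b) + U_(a))] else 0 :> S.
  by case: ifP => _; rewrite ?mulr0 // -mpolyXD addmC.
have cocycle s : size s = 2 -> I (xdiff c s).
  case: s => [|a [|b [|? ?]]] //= _; rewrite subr0 !cE.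
  case: (boolP (a \in B)) (boolP (b \in B)) => aB [] bB.
  - rewrite (_ : (m + U_(a) + U_(b) = m + U_(b) + U_(a))%MM).
      by rewrite subrr; case: hI.
    by rewrite -!addmA [(U_(a) + _)%MM]addmC.
  - by apply: (ideal_sub hI); [case: hI | apply: I_cross].
  - by rewrite subr0; apply: I_cross.
  - by rewrite subr0; case: hI.
have [v hv] := ex c cocycle.
have coef t : R (m + U_(t))%MM -> (v [::])@_m = (t \in B)%:R.
  move=> Rt; have /(mcoeff_standard monI)/(_ Rt) := hv [:: t] erefl.
  rewrite /= subr0 mcoeffB mcoeffXM lem_addl addmK => /eqP; rewrite subr_eq0.
  by move/eqP <-; case: ifP => _; rewrite ?mcoeff0 // mcoeffX eqxx.
have /eqP := etrans (esym (coef i Ri)) (coef j Rj).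
by rewrite iB (negbTE jB) oner_eq0.
Qed.

(** Otherwise the cochain with value x^m at i alone is a cocycle, although x^m
    is not divisible by x_i. *)
Lemma koszul_exact1_two_directions m i : koszul_exact I 1 -> R m -> m i = 0%N ->
  exists2 j, j != i & R (m + U_(j))%MM.
Proof.
move=> ex Rm mi; apply: NNPP => no.
pose c (s : seq 'I_n) : S := if s is t :: _ then (t == i)%:R * 'X_[m] else 0.
have Im j : j != i -> I ('X_j * 'X_[m]).
  move=> ji; rewrite -mpolyXD addmC; apply: nstandard.
  by apply/negP => Rj; apply: no; exists j.
have cocycle s : size s = 2 -> I (xdiff c s).
  case: s => [|a [|b [|? ?]]] //= _; rewrite subr0.
  case: (eqVneq a i) => [->|ai]; case: (eqVneq b i) => [->|bi].
  - by rewrite subrr; case: hI.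
  - rewrite mul0r mulr0 mul1r; apply: (ideal_sub hI); [by case: hI | exact: Im].
  - by rewrite mul0r mulr0 mul1r subr0; apply: Im.
  - by rewrite !mul0r !mulr0 subr0; case: hI.
have [v hv] := ex c cocycle.
have /(mcoeff_standard monI)/(_ Rm) := hv [:: i] erefl.
rewrite /= eqxx mul1r subr0 mcoeffB mcoeffX eqxx mcoeffXM lep1mP mi subr0.
by move/eqP; rewrite oner_eq0.
Qed.

(** For a second extending variable besides x_i, go down to exponent 0 in x_i
    and climb back: at each step connectedness of the graph, cut at i, carries
    the second variable one level up. *)
Lemma koszul_exact1_locally_connected : koszul_exact I 1 -> locally_connected R.
Proof.
move=> ex m Rm; split; last by move=> B i j; apply: koszul_exact1_connected.
move=> i; move e: (m i) => k; elim: k => [|k IH] in m Rm e *.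
  exact: koszul_exact1_two_directions.
have em : (m - U_(i) + U_(i))%MM = m by rewrite submK // lep1mP e.
have [||j ji Rj] := IH (m - U_(i))%MM.
- by apply: (standard_down_closed monI) Rm; apply: lem_subr.
- by rewrite mnmBE mnm1E eqxx e subn1.
have [||||i' [j' []]] := @koszul_exact1_connected (m - U_(i))%MM [set i] i j ex.
- by rewrite inE.
- by rewrite inE.
- by rewrite em.
- by [].
by rewrite inE => /eqP ->; rewrite inE em; exists j'.
Qed.

End LowDegrees.

(** * Exactness in higher degrees *)

Section NonPrincipal.
Variables (n : nat) (R : pred 'X_{1..n}).
Hypothesis dR : down_closed R.

(** Combinatorial source of a first syzygy. Take b minimal such that the monomials
    of I dividing b have no smallest element. For each variable x_c dividing b
    with b / x_c in I, minimality of b gives a smallest monomial [lab c] of I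
    dividing b / x_c. The labels of c and d agree as soon as b / (x_c x_d) is in
    I, and they are not all equal, since a common label would be smallest
    below b. *)
Lemma nonprincipal_lcm : (exists m, ~~ R m) ->
  ~ (exists u, forall m, R m = ~~ (u <= m)%MM) ->
  exists (b : 'X_{1..n}) (lab : 'I_n -> 'X_{1..n}) (i j : 'I_n),
    [/\ lab i != lab j,
        exists2 w, ~~ R w & (w + U_(i))%MM = b,
        exists2 w, ~~ R w & (w + U_(j))%MM = b &
        forall c d w, ~~ R w -> (w + U_(c) + U_(d))%MM = b -> lab c = lab d].
Proof.
move=> [m0 nR0] nonp.
pose least b u := [/\ ~~ R u, (u <= b)%MM &
  forall w, (w <= b)%MM -> ~~ R w -> (u <= w)%MM].
pose P b := ~~ R b /\ ~ exists u, least b u.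
have anti (u w : 'X_{1..n}) : (u <= w)%MM -> (w <= u)%MM -> u = w.
  move=> /mnm_lepP uw /mnm_lepP wu; apply/mnmP => i.
  by apply/eqP; rewrite eqn_leq uw wu.
have [b0 Pb0] : exists b, P b.
  apply: NNPP => noP; apply: nonp.
  have leastP b : ~~ R b -> exists u, least b u.
    by move=> nRb; apply: NNPP => h; apply: noP; exists b.
  have [u [nRu um0 minu]] := leastP m0 nR0; exists u => m.
  apply/idP/idP => [Rm|]; first by apply: contra nRu => /dR; apply.
  apply: contraR => nRm; have nRb : ~~ R (m0 + m)%MM.
    by apply: contra nRm; apply: dR; apply: lem_addl.
  have [u' [nRu' _ minu']] := leastP _ nRb.
  have u'm : (u' <= m)%MM by apply: minu' => //; apply: lem_addl.
  have u'u : (u' <= u)%MM.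
    by apply: minu' => //; apply: lepm_trans um0 (lem_addr _ _).
  rewrite (anti u u') //; apply: minu => //; exact: lepm_trans u'u um0.
have [b [nRb nb] minb] : exists2 b, P b & forall b', (mdeg b' < mdeg b)%N -> ~ P b'.
  have [k] := ubnP (mdeg b0); elim: k => // k IH in b0 Pb0 *; rewrite ltnS => le.
  case: (classic (exists2 b', (mdeg b' < mdeg b0)%N & P b')).
    by move=> [b' lt Pb']; apply: IH Pb' _; apply: leq_trans lt le.
  by move=> no; exists b0 => // b' lt Pb'; apply: no; exists b'.
have mem_pred w : ~~ R w -> (w <= b)%MM -> w != b ->
    exists c x, [/\ ~~ R x, (x + U_(c))%MM = b & (w <= x)%MM].
  move=> nRw /mnm_lepP wb ne; have [c lt] : exists c, (w c < b c)%N.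
    apply/existsP; apply: contraR ne; rewrite negb_exists => /forallP ge.
    by apply/eqP/mnmP => c; apply/eqP; rewrite eqn_leq wb leqNgt ge.
  have eb : (b - U_(c) + U_(c))%MM = b by rewrite submK // lep1mP; lia.
  have wx : (w <= b - U_(c))%MM.
    apply/mnm_lepP => d; rewrite mnmBE mnm1E; have := wb d.
    by case: eqVneq => [<-|_] /=; lia.
  exists c, (b - U_(c))%MM; split=> //.
  by apply: contra nRw; apply: dR.
have lab_ex c : exists l, forall x, ~~ R x -> (x + U_(c))%MM = b -> least x l.
  case: (classic (exists2 x, ~~ R x & (x + U_(c))%MM = b)); last first.
    by move=> no; exists 0%MM => x nRx e; case: no; exists x.
  move=> [x nRx e]; have [l hl] : exists l, least x l.
    apply: NNPP => h; apply: (minb x) => //.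
    by rewrite -e mdegD mdeg1 addn1.
  by exists l => x' _ e'; rewrite (addIm (etrans e' (esym e))).
pose lab c := proj1_sig (constructive_indefinite_description _ (lab_ex c)).
have labP c x : ~~ R x -> (x + U_(c))%MM = b -> least x (lab c).
  by rewrite /lab; case: constructive_indefinite_description => l; apply.
have [w [wb nRw wne]] : exists w, [/\ (w <= b)%MM, ~~ R w & w != b].
  apply: NNPP => no; apply: nb; exists b; split=> // [|w wb nRw].
    exact: lepm_refl.
  by case: (eqVneq w b) => [->|ne]; [exact: lepm_refl | case: no; exists w].
have [i [x [nRx xb wx]]] := mem_pred w nRw wb wne.
have [nRl lx minl] := labP i x nRx xb.
have [w' [w'b nRw' lw']] :
    exists w', [/\ (w' <= b)%MM, ~~ R w' & ~~ (lab i <= w')%MM].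
  apply: NNPP => no; apply: nb; exists (lab i); split=> // [|w' w'b nRw'].
    by apply: lepm_trans lx _; rewrite -xb lem_addr.
  by apply: contraT => h; case: no; exists w'.
have w'ne : w' != b.
  apply: contra lw' => /eqP ->; apply: lepm_trans lx _; rewrite -xb; exact: lem_addr.
have [j [x' [nRx' x'b w'x']]] := mem_pred w' nRw' w'b w'ne.
have [_ _ minl'] := labP j x' nRx' x'b.
exists b, lab, i, j; split; first last.
- move=> c d y nRy e.
  have e' : (y + U_(d) + U_(c))%MM = b by rewrite -e -!addmA [(U_(c) + _)%MM]addmC.
  have up k : ~~ R (y + U_(k))%MM.
    by apply: contra nRy; apply: dR; apply: lem_addr.
  have [nRc _ minc] := labP c _ (up d) e'.
  have [nRd _ mind] := labP d _ (up c) e.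
  have yk k : (y <= y + U_(k))%MM by apply: lem_addr.
  apply: anti; [apply: minc | apply: mind] => //.
    by apply: lepm_trans (mind y (yk c) nRy) (yk d).
  by apply: lepm_trans (minc y (yk d) nRy) (yk c).
- by exists x'.
- by exists x.
by apply: contraNneq lw' => ->; apply: minl'.
Qed.
End NonPrincipal.

Section TopDegrees.
Variables (n : nat) (K : fieldType) (I : {mpoly K[n]} -> Prop).
Hypothesis monI : monomial_ideal I.
Local Notation S := {mpoly K[n]}.
Local Notation R := (standard I).
Let hI : is_ideal I := monomial_is_ideal monI.

(** The fundamental class: its value 1 at the full word cannot be corrected by
    a coboundary, whose values lie in the ideal of the variables. *)
Lemma koszul_not_exact_top : koszul_exact I n -> ~~ R 0%MM.
Proof.
move=> ex; apply/negP => R0; pose J := enum 'I_n.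
have cocycle s : size s = n.+1 -> I (xdiff (fun t => 'X_[0%MM] * wedge S J t) s).
  by move=> _; apply: wedge_cocycle => // i; rewrite mem_enum.
have [v hv] := ex _ cocycle.
have /(mcoeff_standard monI)/(_ R0) := hv J (size_enum_ord n).
rewrite wedge_diag ?enum_uniq // mulr1 mcoeffB mcoeffX eqxx.
have -> : (xdiff v J)@_0%MM = 0.
  apply: (@kdiff_closed _ _ (fun f => f@_0%MM = 0)) => [|f g f0 g0|i t _].
  - exact: mcoeff0.
  - by rewrite mcoeffB f0 g0 subrr.
  - by rewrite mcoeffXM lep1mP mnm0E.
by rewrite subr0 => /eqP; rewrite oner_eq0.
Qed.

(** For I = (u) and x_i dividing u, the monomial u / x_i times the cochain dual
    to the other variables is a cocycle m. Were it a coboundary d v modulo I,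
    the differential of m - d v at the full word would have coefficient 0 at u,
    as m - d v takes values in (u); but this differential is that of m, which
    is u there. *)
Lemma koszul_exact_hypersurface u i : koszul_exact I n.-1 ->
  (forall m, R m = ~~ (u <= m)%MM) -> u i = 0%N.
Proof.
move=> ex Ru; apply/eqP; apply: contraT => ui.
pose J := [seq j <- enum 'I_n | j != i].
have sJ : size (i :: J) = n.
  rewrite /= size_filter -[RHS]size_enum_ord -(count_predC (pred1 i)).
  by rewrite count_uniq_mem ?enum_uniq // mem_enum.
have uJ : uniq (i :: J).
  by rewrite /= mem_filter eqxx filter_uniq // enum_uniq.
have eu : (u - U_(i) + U_(i))%MM = u by rewrite submK // lep1mP.
pose m t := 'X_[(u - U_(i))] * wedge S J t.
have Iu : I 'X_[u] by apply: nstandard; rewrite Ru negbK lepm_refl.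
have cocycle s : size s = n.-1.+1 -> I (xdiff m s).
  move=> _; apply: wedge_cocycle => // j; rewrite mem_filter mem_enum andbT negbK.
  by move=> /eqP ->; rewrite eu.
have [v hv] := ex m cocycle.
(* The word i :: J is hidden in a variable so that simplification does not
   unfold the differential. *)
have [s4 es4] : exists s, s = i :: J by exists (i :: J).
have e1 : (xdiff (fun t => m t - xdiff v t) s4)@_u = 1.
  have mZ t : kdiff (unit_weight S t) m s4 =
      'X_[(u - U_(i))] * kdiff (unit_weight S t) (wedge S J) s4.
    exact: kdiffZ.
  have w1 : kdiff (unit_weight S i) (wedge S J) s4 = 1 .
    by rewrite es4; apply: wedge_diag uJ.
  rewrite /xdiff kdiffB kdiffK subr0 kdiff_unit_weights (bigD1 i) //= big1.
    by rewrite addr0 mZ w1 mulr1 -mpolyXD addmC eu mcoeffX eqxx.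
  move=> j ji; rewrite mZ kdiff_wedge_mem ?mulr0 //.
  by rewrite mem_filter ji mem_enum.
have e0 : (xdiff (fun t => m t - xdiff v t) s4)@_u = 0.
  apply: (@kdiff_closed _ _ (fun f => f@_u = 0)) => [|f g f0 g0|j t et].
  - exact: mcoeff0.
  - by rewrite mcoeffB f0 g0 subrr.
  rewrite mcoeffXM; case: ifP => // uj; apply: (mcoeff_standard monI).
    by apply: hv; rewrite es4 sJ in et; exact: (congr1 predn et).
  rewrite Ru; apply/negP => /mnm_lepP/(_ j); rewrite mnmBE mnm1E eqxx.
  by move: uj; rewrite lep1mP; lia.
by move: e1; rewrite e0 => /esym/eqP; rewrite oner_eq0.
Qed.
End TopDegrees.

Section DegreeTwo.
Variables (K : fieldType) (I : {mpoly K[4]} -> Prop).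
Hypothesis monI : monomial_ideal I.
Local Notation S := {mpoly K[4]}.
Local Notation R := (standard I).
Let hI : is_ideal I := monomial_is_ideal monI.

(** With b and the labels of [nonprincipal_lcm], and lab i different from lab j,
    the monomial b / (x_i x_j) times the cochain dual to the remaining two
    variables k, l is a cocycle. Let it be the coboundary of v modulo I, and let C t
    be the coefficient of b in v_t times the variables other than x_t. If the
    labels of c and d differ, then b / (x_c x_d) is not a monomial of I, and
    comparing coefficients there gives C l - C k = 1 for {c, d} = {i, j}, and
    C a = C a' when {a, a'} is the complement of {c, d} and contains i or j.
    As the labels of i and j differ, enough pairs are available to connect k
    with l, whence C k = C l. *)
Lemma koszul_exact2_principal : koszul_exact I 2 -> (exists m, ~~ R m) ->
  exists u, forall m, R m = ~~ (u <= m)%MM.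
Proof.
move=> ex nR; apply: NNPP => nonp.
have [b [lab [i [j [lij [wi nRi ei] [wj nRj ej] edge]]]]] :=
  nonprincipal_lcm (standard_down_closed monI) nR nonp.
have ij : i != j by apply: contraNneq lij => ->.
have /cards2P[k [l [kl ekl]]] : #|~: [set i; j]| == 2.
  by rewrite cardsCs setCK cards2 ij card_ord.
have inkl t : (t \in [:: k; l]) = (t != i) && (t != j).
  have := congr1 (fun B : {set 'I_4} => t \in B) ekl.
  by rewrite !inE negb_or => ->.
have [ki kj] : k != i /\ k != j by apply/andP; rewrite -inkl !inE eqxx.
have [li lj] : l != i /\ l != j by apply/andP; rewrite -inkl !inE eqxx orbT.
have [q qi qj] : exists2 q, (q + U_(i))%MM = wj & (q + U_(j))%MM = wi.
  have wji : wj i != 0%N.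
    have := congr1 (fun m : 'X_{1..4} => m i) (etrans ej (esym ei)).
    by rewrite !mnmDE !mnm1E eqxx eq_sym (negbTE ij); lia.
  exists (wj - U_(i))%MM; first by rewrite submK ?lep1mP.
  apply: (@addIm _ U_(i)%MM); rewrite ei -ej -addmA [(U_(j) + _)%MM]addmC addmA.
  by rewrite submK ?lep1mP.
pose m t := 'X_[q] * wedge S [:: k; l] t.
have cocycle s : size s = 3 -> I (xdiff m s).
  move=> _; apply: wedge_cocycle => // t; rewrite inkl negb_and !negbK.
  by case/orP => /eqP ->; rewrite ?qi ?qj; apply: nstandard.
have [v hv] := ex m cocycle.
pose others t : 'X_{1..4} := [multinom nat_of_bool (s != t) | s < 4].
pose C t := ('X_[others t] * v [:: t])@_b.
have othersE a a' c d : uniq [:: a; a'; c; d] ->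
    others a = (U_(c) + U_(d) + U_(a'))%MM.
  move=> un; apply/mnmP => t; rewrite mnmE !mnmDE !mnm1E.
  have := mem_uniq4 un t; have /and4P[] := un.
  rewrite !inE !negb_or => /and3P[aa' ac ad] /andP[a'c a'd] cd _.
  have F (x y : 'I_4) : x != y -> (x == y = false) * (y == x = false).
    by move=> xy; rewrite [y == x]eq_sym !(negbTE xy).
  by case/or4P => /eqP ->; rewrite ?eqxx ?(F _ _ aa') ?(F _ _ ac) ?(F _ _ ad)
    ?(F _ _ a'c) ?(F _ _ a'd) ?(F _ _ cd).
have gap a a' c d : uniq [:: a; a'; c; d] -> lab c != lab d ->
    C a' - C a = ('X_[U_(c) + U_(d)] * m [:: a; a'])@_b.
  move=> un neq; have I0 := hv [:: a; a'] erefl.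
  have un' : uniq [:: a'; a; c; d].
    rewrite (perm_uniq (s2 := [:: a; a'; c; d])) //.
    exact/permPl/(perm_catCA [:: _] [:: _]).
  have coef0 : ('X_[U_(c) + U_(d)] * (m [:: a; a'] - xdiff v [:: a; a']))@_b = 0.
    rewrite mcoeffXM; case: ifP => // cdb; apply: (mcoeff_standard monI) => //.
    apply: contraT => nw; case/negP: neq; apply/eqP; apply: edge nw _.
    by rewrite -addmA submK.
  rewrite /C (othersE _ _ _ _ un) (othersE _ _ _ _ un').
  apply/esym/eqP; rewrite -subr_eq0 -!mcoeffB; apply/eqP; rewrite -[RHS]coef0.
  congr (_@_b); rewrite /= !mpolyXD; ring.
have un : uniq [:: k; l; i; j].
  by rewrite /= !inE !negb_or kl ki kj li lj ij.
have C_kl : C l - C k = 1.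
  rewrite (gap _ _ _ _ un lij) /m (wedge_diag S (J := [:: k; l])).
    by rewrite mulr1 -mpolyXD mcoeffX addmC addmA qi ej eqxx.
  by rewrite /= inE kl.
have C_eq a a' c d : uniq [:: a; a'; c; d] -> a \notin [:: k; l] ->
    lab c != lab d -> C a' = C a.
  move=> un1 akl neq; apply/eqP; rewrite -subr_eq0 (gap _ _ _ _ un1 neq).
  have [ak al] : (a == k) = false /\ (a == l) = false.
    by split; apply: contraNF akl => /eqP ->; rewrite !inE eqxx ?orbT.
  rewrite /m /= /unit_weight ak al !(mul0r, mulr0, subr0).
  by rewrite mcoeff0.
have inotkl : i \notin [:: k; l] by rewrite inkl eqxx.
have jnotkl : j \notin [:: k; l] by rewrite inkl eqxx andbF.
have [[ik jk] [il jl] [ji lk]] :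
    [/\ i != k /\ j != k, i != l /\ j != l & j != i /\ l != k].
  by rewrite ![i == _]eq_sym ![j == _]eq_sym [l == _]eq_sym ki kj li lj ij kl.
have Cik : lab j != lab l -> C k = C i.
  by apply: C_eq => //; rewrite /= !inE !negb_or ik ij il kj kl jl.
have Cil : lab j != lab k -> C l = C i.
  by apply: C_eq => //; rewrite /= !inE !negb_or il ij ik lj lk jk.
have Cjk : lab i != lab l -> C k = C j.
  by apply: C_eq => //; rewrite /= !inE !negb_or jk ji jl ki kl il.
have Cjl : lab i != lab k -> C l = C j.
  by apply: C_eq => //; rewrite /= !inE !negb_or jl ji jk li lk ik.
have Cij : lab k != lab l -> C j = C i.
  by apply: C_eq => //; rewrite /= !inE !negb_or ij ik il jk jl kl.
suff e : C k = C l by move/eqP: C_kl; rewrite e subrr eq_sym oner_eq0.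
case: (eqVneq (lab k) (lab l)) => [lkl|nkl].
  case: (eqVneq (lab i) (lab k)) => [lik|nik].
    have njk : lab j != lab k by rewrite -lik eq_sym.
    by rewrite (Cil njk) Cik // -lkl.
  by rewrite (Cjl nik) Cjk // -lkl.
have eij := Cij nkl.
transitivity (C i).
  case: (eqVneq (lab j) (lab l)) => [ljl|/Cik //].
  by rewrite -eij; apply: Cjk; rewrite -ljl.
case: (eqVneq (lab j) (lab k)) => [ljk|/Cil //].
by rewrite -eij; apply/esym/Cjl; rewrite -ljk.
Qed.

End DegreeTwo.

(** * The theorem *)

Lemma bounded_max (P : nat -> Prop) b : (exists d, P d) ->
  (forall d, P d -> (d <= b)%N) -> exists2 d, P d & forall e, P e -> (e <= d)%N.
Proof.
move=> [d0 Pd0]; elim: b => [|b IH] bnd.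
  exists d0 => // e /bnd; rewrite leqn0 => /eqP ->; exact: leq0n.
case: (classic (P b.+1)) => [Pb|nPb]; first by exists b.+1.
apply: IH => d Pd; have := bnd d Pd; rewrite leq_eqVlt => /orP[/eqP e|//].
by rewrite e in Pd.
Qed.

Theorem theorem2p4 (K : fieldType) (I : {mpoly K[4]} -> Prop)
  (hI : monomial_ideal I) : stanley_ideal I.
Proof.
have idI := monomial_is_ideal hI; have dR := standard_down_closed hI.
case: (boolP (standard I 0%MM)) => [R0|nR0]; last first.
  apply: (partition_stanley hI); apply: partition_empty => m.
  by apply: contra nR0; apply: dR; apply/mnm_lepP => i; rewrite mnm0E.
(* Used twice: the bound 4 shows that a maximal length exists, so that the depth
   is attained, and the partition is taken for a sequence of that length. *)
have key s : regular_sequence I s ->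
    (forall f, f \in s -> maximal_graded_ideal f) ->
    (size s <= 4)%N /\ orthant_partition (size s) (standard I).
  move=> regs ms; have ex k : (k < size s)%N -> koszul_exact I k.
    exact: regular_koszul_exact.
  have s4 : (size s <= 4)%N.
    by rewrite leqNgt; apply/negP => /ex/(koszul_not_exact_top hI); rewrite R0.
  split=> //; move: (size s) s4 ex => d d4 ex {regs ms s}.
  case: (ltnP 2 d) => d2.
    case: (classic (exists m, ~~ standard I m)) => [|no].
      move=> /(koszul_exact2_principal hI (ex _ d2))[u hu]; have d3 : (d <= 3)%N.
        rewrite leqNgt; apply/negP => /ex ex3; move: R0; rewrite hu.
        case/mnm_lepP => i; rewrite mnm0E leqn0.
        by apply/eqP; exact: (@koszul_exact_hypersurface 4 K I hI u i ex3 hu).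
      apply: (@partition_le _ #|[set: 'I_4]|.-1); first by rewrite cardsT card_ord.
      apply: partition_ext (partition_principal setT u) => m; rewrite hu.
      rewrite (_ : in_orthant _ _) //; apply/forallP => j /=.
      by rewrite mnm0E inE.
    apply: (@partition_le _ #|[set: 'I_4]|); first by rewrite cardsT card_ord.
    apply: partition_ext (partition_orthant 0%MM setT) => m.
    have -> : standard I m by apply: contraT => nm; case: no; exists m.
    by apply/forallP => j /=; rewrite mnm0E inE.
  case: d d2 ex {d4} => [|[|[|//]]] _ ex.
  - by have [g /partition_truncated] := truncated_exists dR.
  - apply: partition_extendable => // m.
    by apply: koszul_exact0_extends => //; apply: ex.
  - apply: partition_locally_connected => //.
    by apply: koszul_exact1_locally_connected => //; exact: ex.
have [d maxd] : exists d, max_regular_length I d.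
  pose P d := exists2 s, regular_sequence I s /\
    (forall f, f \in s -> maximal_graded_ideal f) & size s = d.
  have [|d [s [regs ms] es]|d Pd maxd] := @bounded_max P 4.
  - exists 0%N, [::] => //; split=> //; split=> // /(ideal_add_nil _ idI).
    by rewrite -mpolyX0; apply/standardP.
  - by rewrite -es; have [] := key s regs ms.
  by exists d; split=> // s hs; apply: maxd; exists s.
have [[s [regs ms] sd] _] : max_regular_length I (depth I).
  by apply: epsilon_spec; exists d.
apply: (partition_stanley hI); rewrite -sd.
by have [] := key s regs ms.
Qed.
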